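(* Let $X$ be a nonempty well-ordered set and let $S\subseteq \mathrm{preAs}\langle X\rangle$ be a set of monic pre-associative polynomials. Let $I(S)$ be the ideal of the free pre-associative algebra $\mathrm{preAs}\langle X\rangle$ generated by $S$. Then the following statements are equivalent: (i) $S$ is a Gröbner–Shirshov basis (GSB) in $\mathrm{preAs}\langle X\rangle$; (ii) for every $0\ne f\in I(S)$ one has $\bar f = w*\bar s*w'$ for some $s\in\hat S$ and $w,w'\in U^\#$; (iii) the set of all $\hat S$-reduced words of $U^*$ is (i.e. its image is) a linear basis of $\mathrm{preAs}\langle X\mid S\rangle = \mathrm{preAs}\langle X\rangle/I(S)$.
   Context: Fix a field $\Bbbk$. A pre-associative (dendriform) algebra is a $\Bbbk$-linear space with two bilinear operations $\succ,\prec$ satisfying $x\succ(y\succ z)=(x\succ y)\succ z+(x\prec y)\succ z$, $x\succ(y\prec z)=(x\succ y)\prec z$, $x\prec(y\succ z)+x\prec(y\prec z)=(x\prec y)\prec z$. Put $x*y=x\succ y+x\prec y$ and $xy=x\succ y$. In terms of these operations the axioms are: $*$ is associative, $(a_1*a_2)a_3=a_1(a_2a_3)$, and $a_1(a_2*a_3)=(a_1a_2)*a_3-(a_1a_2)a_3+a_1(a_2a_3)$. $\mathrm{preAs}\langle X\rangle$ is the free pre-associative algebra generated by $X$. Ideals are two-sided with respect to both operations. Words. $U=X^{**}$ is the set of all nonempty non-associative words in $X$ (with respect to the product $xy$), $|u|$ is the length of $u\in U$. $U^*$ is the set of all nonempty associative words $u_1*\dots*u_k$ ($k\ge 1$, $u_i\in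 U$) in the alphabet $U$, $|u_1*\dots*u_k|_*=k$, and $U^\#=U^*\cup\{\epsilon\}$, where $\epsilon$ is the empty word. $U^*$ is a linear basis of $\mathrm{preAs}\langle X\rangle$, which as an associative algebra under $*$ is identified with the free associative algebra $\mathrm{As}\langle U\rangle$; the subspace $\Bbbk U$ under $xy$ is the free non-associative algebra generated by $X$. Order. The well order on $X$ is extended to $U$ by induction on length: with $\mathrm{wt}(x)=(1,x)$ for $x\in X$ and $\mathrm{wt}(u_1u_2)=(|u_1u_2|,u_2,u_1)$, put $u\le v$ iff $\mathrm{wt}(u)\le\mathrm{wt}(v)$ lexicographically. The order on $U$ is extended to a fixed well order on $U^*$ that is monomial with respect to $*$ ($u\le v$ implies $w*u\le w*v$ and $u*w\le v*w$) and such that $|u|_*>1$, $|v|_*=1$ imply $u>v$ (e.g. deg-lex). For $0\ne f\in\mathrm{preAs}\langle X\rangle$, $\bar f\in U^*$ is its principal (greatest) word; $f$ is monic if the coefficient at $\bar f$ is $1$. The set $\hat S$. For a set $S$ of monic polynomials put $S_0=\{f\in S: |\bar f|_*=1\}$ (so $S_0\subset \Bbbk U$), $S_1=S\setminus S_0$, $S_0^{(0)}=S_0$, $S_0^{(k+1)}=\{vf,fv: f\in S_0^{(k)},v\in U\}$, $\hat S_0=\bigcup_{k\ge0}S_0^{(k)}$, $\hat S=\hat S_0\cup S_1$. A word $u\in U^*$ is $\hat S$-reduced if it is not of the form $w*\bar s*w'$ with $s\in\hat S$, $w,w'\in U^\#$. Compositions of monic $f,g$: (C1) if $\bar f=w_1*\bar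 g*w_2$, $w_i\in U^\#$: $h=f-w_1*g*w_2$, relative to $w=\bar f$; (C2) if $\bar f=u*w_1$, $\bar g=w_2*u$ with $u,w_1,w_2\in U^*$: $h=w_2*f-g*w_1$, relative to $w=w_2*\bar f=\bar g*w_1$; (C3) if $|\bar g|_*=1$ and $\bar f=v*u*v'$ with $v,v'\in U^\#$, $u=(w_1\dots w_k\bar g w_1'\dots w'_{k'})\in U$ for some bracketing with respect to the product $xy$, $w_i,w_i'\in U$, $k+k'>0$: $h=f-v*(w_1\dots w_kgw'_1\dots w'_{k'})*v'$ (same bracketing), relative to $w=\bar f$; (C4) if $|\bar f|_*>1$ and $v\in U$: $h=fv$, relative to $w=\overline{fv}$; (C5) if $|\bar f|_*>1$ and $u\in U^*$: $h=uf$, relative to $w=\overline{uf}$. A composition $h$ of type (C1)–(C3) relative to $w$ is trivial modulo $S$ if $h=\sum_i\alpha_i w_i*s_i*w_i'$ (finite sum, possibly empty) with $\alpha_i\in\Bbbk$, $w_i,w_i'\in U^\#$, $s_i\in\hat S$ and $w_i*\bar s_i*w_i'<w$ for all $i$. A composition of type (C4)–(C5) relative to $w$ is trivial modulo $S$ if $h$ has such a presentation with $w_i*\bar s_i*w_i'\le w$ for all $i$ (in particular $h=0$ is trivial). $S$ is a Gröbner–Shirshov basis (GSB) in $\mathrm{preAs}\langle X\rangle$ if for all $f,g\in S$ every composition of type (C1)–(C5) is trivial modulo $S$. *)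

(* Defs.v *)
From HB Require Import structures.
From mathcomp Require Import all_boot all_order all_algebra.
From mathcomp Require Import finmap monalg boolp.

Set Implicit Arguments.
Unset Strict Implicit.
Unset Printing Implicit Defensive.

Import Order.TTheory GRing.Theory.
Local Open Scope ring_scope.

Reserved Notation "x ≻ y" (at level 40, left associativity).
Reserved Notation "x ≺ y" (at level 40, left associativity).
Reserved Notation "x ⋆ y" (at level 40, left associativity).

HB.mixin Record isPreAs (k : fieldType) A of GRing.Lmodule k A := {
  psucc : A -> A -> A;
  pprec : A -> A -> A;
  psucc_linearl : forall y, linear (fun x => psucc x y);
  psucc_linearr : forall x, linear (psucc x);
  pprec_linearl : forall y, linear (fun x => pprec x y);
  pprec_linearr : forall x, linear (pprec x);
  psuccA : forall x y z,
    psucc x (psucc y z) = psucc (psucc x y) z + psucc (pprec x y) z;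
  psuccprecA : forall x y z, psucc x (pprec y z) = pprec (psucc x y) z;
  pprecA : forall x y z,
    pprec x (psucc y z) + pprec x (pprec y z) = pprec (pprec x y) z
}.

#[short(type="preAsType")]
HB.structure Definition PreAs (k : fieldType) :=
  {A of isPreAs k A & GRing.Lmodule k A}.

Notation "x ≻ y" := (psucc x y) : ring_scope.
Notation "x ≺ y" := (pprec x y) : ring_scope.

Definition pstar (k : fieldType) (A : preAsType k) (x y : A) : A :=
  x ≻ y + x ≺ y.

Notation "x ⋆ y" := (pstar x y) : ring_scope.

Record preAs_hom (k : fieldType) (A B : preAsType k) (h : A -> B) : Prop := {
  preAs_hom_linear : linear h;
  preAs_hom_succ : forall x y, h (x ≻ y) = h x ≻ h y;
  preAs_hom_prec : forall x y, h (x ≺ y) = h x ≺ h y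
}.

Definition is_free_preAs (k : fieldType) (X : Type) (A : preAsType k)
    (i : X -> A) : Prop :=
  forall (B : preAsType k) (g : X -> B),
    exists2 h : A -> B, preAs_hom h /\ (forall x, h (i x) = g x)
      & forall h' : A -> B,
          preAs_hom h' -> (forall x, h' (i x) = g x) -> h' =1 h.

Section LinearFun.
Context (k : fieldType) (U V : lmodType k) (h : U -> V).
Hypothesis hL : linear h.

Lemma lfun0 : h 0 = 0.
Proof.
have /= := hL 1 0 0; rewrite !scale1r addr0 => e.
by apply: (addrI (h 0)); rewrite -e addr0.
Qed.
Lemma lfunD x y : h (x + y) = h x + h y.
Proof. by have := hL 1 x y; rewrite !scale1r. Qed.
Lemma lfunZ a x : h (a *: x) = a *: h x.
Proof. by have := hL a x 0; rewrite !addr0 lfun0 addr0. Qed.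
Lemma lfunN x : h (- x) = - h x.
Proof. by rewrite -!scaleN1r lfunZ. Qed.
Lemma lfunB x y : h (x - y) = h x - h y.
Proof. by rewrite lfunD lfunN. Qed.
Lemma lfun_sum I (r : seq I) (F : I -> U) :
  h (\sum_(i <- r) F i) = \sum_(i <- r) h (F i).
Proof. by elim: r => [|i r IH]; rewrite ?big_nil ?lfun0 // !big_cons lfunD IH. Qed.
End LinearFun.

Section Ideals.
Context (k : fieldType) (A : preAsType k).

Record preAs_ideal (I : A -> Prop) : Prop := {
  ideal0 : I 0;
  ideal_lin : forall (a : k) x y, I x -> I y -> I (a *: x + y);
  ideal_succl : forall x y, I y -> I (x ≻ y);
  ideal_succr : forall x y, I x -> I (x ≻ y);
  ideal_precl : forall x y, I y -> I (x ≺ y);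
  ideal_precr : forall x y, I x -> I (x ≺ y)
}.

Definition ideal_gen (S : A -> Prop) (f : A) : Prop :=
  forall I : A -> Prop, preAs_ideal I -> (forall s, S s -> I s) -> I f.

Lemma ideal_gen_ideal S : preAs_ideal (ideal_gen S).
Proof.
split.
- by move=> I hI _; exact: (ideal0 hI).
- by move=> a x y hx hy I hI hS; exact: (ideal_lin hI) (hx I hI hS) (hy I hI hS).
- by move=> x y h I hI hS; exact: (ideal_succl hI) (h I hI hS).
- by move=> x y h I hI hS; exact: (ideal_succr hI) (h I hI hS).
- by move=> x y h I hI hS; exact: (ideal_precl hI) (h I hI hS).
- by move=> x y h I hI hS; exact: (ideal_precr hI) (h I hI hS).
Qed.

Context (S : A -> Prop).

Definition ideal_genb : A -> bool := fun f => `[< ideal_gen S f >].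

Lemma ideal_genbP f : reflect (ideal_gen S f) (f \in ideal_genb).
Proof. exact: asboolP. Qed.

Lemma ideal_genb_zmod_closed : zmod_closed ideal_genb.
Proof.
have hI := ideal_gen_ideal S.
split; first by apply/ideal_genbP; exact: (ideal0 hI).
move=> x y /ideal_genbP hx /ideal_genbP hy; apply/ideal_genbP.
by rewrite addrC -scaleN1r; exact: (ideal_lin hI).
Qed.

HB.instance Definition _ :=
  GRing.isZmodClosed.Build A ideal_genb ideal_genb_zmod_closed.

Definition preAs_quot :=
  Quotient.quot (GRing.ZmodClosed.clone A ideal_genb _).

HB.instance Definition _ := GRing.Zmodule.on preAs_quot.
HB.instance Definition _ := EqQuotient.on preAs_quot.

Definition quot_pi (f : A) : preAs_quot := (\pi_(preAs_quot) f)%qT.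

Lemma quot_piP f g : quot_pi f = quot_pi g <-> ideal_gen S (f - g).
Proof.
split=> [e|/ideal_genbP h].
  by apply/ideal_genbP; rewrite Quotient.idealrBE; apply/eqP.
by apply/eqP; rewrite -Quotient.idealrBE.
Qed.

Lemma quot_pi_surj q : exists f, q = quot_pi f.
Proof. by exists (repr q); rewrite /quot_pi reprK. Qed.


Lemma quot_piD f g : quot_pi (f + g) = quot_pi f + quot_pi g.
Proof. exact: (raddfD (\pi_(preAs_quot)%qT)). Qed.

Lemma quot_lift_eq (F : A -> A) (x : A) : linear F ->
  (forall y, ideal_gen S y -> ideal_gen S (F y)) ->
  quot_pi (F (repr (quot_pi x))) = quot_pi (F x).
Proof.
move=> FL FI; apply/quot_piP; rewrite -lfunB //; apply: FI.
by apply/quot_piP; rewrite /quot_pi reprK.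
Qed.

Definition quot_scale (a : k) (q : preAs_quot) : preAs_quot :=
  quot_pi (a *: repr q).
Definition quot_succ (p q : preAs_quot) : preAs_quot :=
  quot_pi (repr p ≻ repr q).
Definition quot_prec (p q : preAs_quot) : preAs_quot :=
  quot_pi (repr p ≺ repr q).

Lemma quot_piZ a f : quot_pi (a *: f) = quot_scale a (quot_pi f).
Proof.
rewrite /quot_scale (quot_lift_eq (F := fun x => a *: x)) //.
  by move=> b x y; rewrite scalerDr !scalerA mulrC.
move=> y hy; have hI := ideal_gen_ideal S.
by rewrite -[_ *: _]addr0; apply: (ideal_lin hI) => //; exact: (ideal0 hI).
Qed.

Lemma quot_pi_succ f g : quot_pi (f ≻ g) = quot_succ (quot_pi f) (quot_pi g).
Proof.
have hI := ideal_gen_ideal S.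
rewrite /quot_succ (quot_lift_eq (F := psucc _)); last 2 first.
- exact: psucc_linearr.
- by move=> y hy; exact: (ideal_succl hI).
rewrite (quot_lift_eq (F := fun x => x ≻ g)) //; first exact: psucc_linearl.
by move=> y hy; exact: (ideal_succr hI).
Qed.

Lemma quot_pi_prec f g : quot_pi (f ≺ g) = quot_prec (quot_pi f) (quot_pi g).
Proof.
have hI := ideal_gen_ideal S.
rewrite /quot_prec (quot_lift_eq (F := pprec _)); last 2 first.
- exact: pprec_linearr.
- by move=> y hy; exact: (ideal_precl hI).
rewrite (quot_lift_eq (F := fun x => x ≺ g)) //; first exact: pprec_linearl.
by move=> y hy; exact: (ideal_precr hI).
Qed.

Lemma quot_scaleA a b q : quot_scale a (quot_scale b q) = quot_scale (a * b) q.
Proof. by have [f ->] := quot_pi_surj q; rewrite -!quot_piZ scalerA. Qed.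
Lemma quot_scale1 : left_id 1 quot_scale.
Proof. by move=> q; have [f ->] := quot_pi_surj q; rewrite -quot_piZ scale1r. Qed.
Lemma quot_scaleDr : right_distributive quot_scale +%R.
Proof.
move=> a p q; have [f ->] := quot_pi_surj p; have [g ->] := quot_pi_surj q.
by rewrite -quot_piD -!quot_piZ -quot_piD scalerDr.
Qed.
Lemma quot_scaleDl q : {morph quot_scale^~ q : a b / a + b}.
Proof.
by move=> a b /=; have [f ->] := quot_pi_surj q; rewrite -!quot_piZ -quot_piD scalerDl.
Qed.

HB.instance Definition _ := GRing.Zmodule_isLmodule.Build k preAs_quot
  quot_scaleA quot_scale1 quot_scaleDr quot_scaleDl.

Lemma quot_pi_linear : linear quot_pi.
Proof. by move=> a f g; rewrite quot_piD quot_piZ. Qed.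

Fact quot_succ_linearl q : linear (fun p => quot_succ p q).
Proof.
move=> a p p'; have [f ->] := quot_pi_surj p; have [f' ->] := quot_pi_surj p'.
have [g ->] := quot_pi_surj q.
by rewrite -quot_pi_linear -!quot_pi_succ psucc_linearl quot_pi_linear.
Qed.
Fact quot_succ_linearr q : linear (quot_succ q).
Proof.
move=> a p p'; have [f ->] := quot_pi_surj p; have [f' ->] := quot_pi_surj p'.
have [g ->] := quot_pi_surj q.
by rewrite -quot_pi_linear -!quot_pi_succ psucc_linearr quot_pi_linear.
Qed.
Fact quot_prec_linearl q : linear (fun p => quot_prec p q).
Proof.
move=> a p p'; have [f ->] := quot_pi_surj p; have [f' ->] := quot_pi_surj p'.
have [g ->] := quot_pi_surj q.
by rewrite -quot_pi_linear -!quot_pi_prec pprec_linearl quot_pi_linear.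
Qed.
Fact quot_prec_linearr q : linear (quot_prec q).
Proof.
move=> a p p'; have [f ->] := quot_pi_surj p; have [f' ->] := quot_pi_surj p'.
have [g ->] := quot_pi_surj q.
by rewrite -quot_pi_linear -!quot_pi_prec pprec_linearr quot_pi_linear.
Qed.
Fact quot_succA p q r : quot_succ p (quot_succ q r) =
  quot_succ (quot_succ p q) r + quot_succ (quot_prec p q) r.
Proof.
have [f ->] := quot_pi_surj p; have [g ->] := quot_pi_surj q.
have [h ->] := quot_pi_surj r.
by rewrite -!(quot_pi_succ, quot_pi_prec) psuccA quot_piD.
Qed.
Fact quot_succprecA p q r :
  quot_succ p (quot_prec q r) = quot_prec (quot_succ p q) r.
Proof.
have [f ->] := quot_pi_surj p; have [g ->] := quot_pi_surj q.
have [h ->] := quot_pi_surj r.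
by rewrite -!(quot_pi_succ, quot_pi_prec) psuccprecA.
Qed.
Fact quot_precA p q r :
  quot_prec p (quot_succ q r) + quot_prec p (quot_prec q r) =
  quot_prec (quot_prec p q) r.
Proof.
have [f ->] := quot_pi_surj p; have [g ->] := quot_pi_surj q.
have [h ->] := quot_pi_surj r.
by rewrite -!(quot_pi_succ, quot_pi_prec) -quot_piD pprecA.
Qed.

HB.instance Definition _ := isPreAs.Build k preAs_quot
  quot_succ_linearl quot_succ_linearr quot_prec_linearl quot_prec_linearr
  quot_succA quot_succprecA quot_precA.

Lemma quot_pi_hom : preAs_hom quot_pi.
Proof.
by split; [exact: quot_pi_linear|exact: quot_pi_succ|exact: quot_pi_prec].
Qed.

End Ideals.

Inductive naword (X : Type) : Type :=
| Gen of X
| Mul of naword X & naword X.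

Section NawordChoice.
Context (X : choiceType).

Fixpoint naword_encode (u : naword X) : GenTree.tree X :=
  match u with
  | Gen x => GenTree.Leaf x
  | Mul u v => GenTree.Node 0 [:: naword_encode u; naword_encode v]
  end.

Fixpoint naword_decode (t : GenTree.tree X) : option (naword X) :=
  match t with
  | GenTree.Leaf x => Some (Gen x)
  | GenTree.Node _ [:: t1; t2] =>
      match naword_decode t1, naword_decode t2 with
      | Some u, Some v => Some (Mul u v)
      | _, _ => None
      end
  | _ => None
  end.

Lemma naword_encodeK : pcancel naword_encode naword_decode.
Proof. by elim=> //= u -> v ->. Qed.

HB.instance Definition _ := Choice.copy (naword X) (pcan_type naword_encodeK).

Record word := Word { wseq :> seq (naword X); wseq_neq0 : wseq != [::] }.

HB.instance Definition _ := [isSub for wseq].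
HB.instance Definition _ := [Choice of word by <:].

Definition consw (u : naword X) (p : seq (naword X)) : word :=
  @Word (u :: p) isT.

Definition letter (u : naword X) : word := consw u [::].

Fact wcat3_neq0 (p : seq (naword X)) (w : word) (q : seq (naword X)) :
  p ++ w ++ q != [::].
Proof. by case: w => -[|u w] //= _; case: p. Qed.

Definition wcat3 p w q : word := Word (wcat3_neq0 p w q).

Definition wcat (u v : word) : word := wcat3 u v [::].

Lemma consw_ind (P : word -> Prop) :
  (forall u p, P (consw u p)) -> forall w, P w.
Proof.
move=> h [[|u p] hw] //; have := h u p.
by congr P; apply: val_inj.
Qed.

End NawordChoice.

HB.lock Definition lext (k : fieldType) (K : choiceType) (V : lmodType k)
    (b : K -> V) (f : {malg k[K]}) : V := \sum_(u <- msupp f) f@_u *: b u.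

Section LinearExtension.
Context (k : fieldType) (K : choiceType) (V : lmodType k) (b : K -> V).
Local Notation lext := (lext b).

Lemma lextE f : lext f = \sum_(u <- msupp f) f@_u *: b u.
Proof. by rewrite unlock. Qed.

Lemma lextEw (d : {fset K}) (f : {malg k[K]}) : (msupp f `<=` d)%fset ->
  lext f = \sum_(u <- d) f@_u *: b u.
Proof.
move=> le; rewrite lextE [RHS](big_fsetID _ (mem (msupp f))) /=.
rewrite [X in _ + X]big1_fset ?addr0; last first.
  move=> u; rewrite !inE /= => /andP[_ /mcoeff_outdom ->] _.
  by rewrite scale0r.
by apply: eq_fbig => // u; rewrite !inE andbC; case: (boolP (u \in _)) => // /(fsubsetP le).
Qed.

Lemma lext_linear : linear lext.
Proof.
move=> a f g; pose d := (msupp f `|` (msupp g `|` msupp (a *: f + g)))%fset.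
rewrite !(@lextEw d) /d ?fsubsetUl //; last 2 first.
- by rewrite fsetUCA fsubsetUl.
- by rewrite fsetUA fsubsetUr.
rewrite scaler_sumr -big_split /=; apply: eq_bigr => u _.
by rewrite mcoeffD mcoeffZ scalerDl scalerA.
Qed.

Lemma lextU u : lext << u >> = b u.
Proof. by rewrite lextE msuppU oner_eq0 big_seq_fset1 mcoeffUU scale1r. Qed.
End LinearExtension.

(* The free pre-associative algebra, realized on the free associative algebra *)
(* As<U>: a formal linear combination of nonempty words over U. Its universal *)
(* property is [freePreAs_is_free] below.                                     *)
Definition freePreAs (k : fieldType) (X : choiceType) : Type :=
  {malg k[word X]}.

HB.instance Definition _ (k : fieldType) (X : choiceType) :=
  GRing.Lmodule.on (freePreAs k X).

HB.lock Definition wmon (k : fieldType) (X : choiceType) (w : word X) :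
  freePreAs k X := << w >>.

Lemma wmonE (k : fieldType) (X : choiceType) (w : word X) :
  wmon k w = << w >>.
Proof. by rewrite unlock. Qed.

Section FreePreAs.
Context (k : fieldType) (X : choiceType).

Local Notation U := (naword X).
Local Notation W := (word X).

Local Notation freePreAs := (freePreAs k X).
Local Notation wmon := (@wmon k X).

Definition umon (u : U) : freePreAs := wmon (letter u).
Definition gmon (x : X) : freePreAs := umon (Gen x).

Definition bimul (p : seq U) (f : freePreAs) (q : seq U) : freePreAs :=
  lext (fun w => wmon (wcat3 p w q)) f.

(* [succ_rev t r] is (rev r) ≻ t. Since (a * b) ≻ c = a ≻ (b ≻ c), the axiom  *)
(*   u ≻ (v * c) = (u ≻ v) * c - (u ≻ v) ≻ c + u ≻ (v ≻ c)                    *)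
(* gives, for words s, t and u, v in U,                                       *)
(*   (s * u) ≻ (v * t) = s ≻ (uv * t) - (s * uv) ≻ t + (s * u * v) ≻ t,       *)
(* which determines ≻ on U^*; an empty t contributes 0 to the last two terms. *)
Fixpoint succ_rev (t : seq U) : seq U -> freePreAs :=
  match t with
  | [::] => fun=> 0
  | v :: t' =>
      (fix rec (r : seq U) : U -> freePreAs :=
         match r with
         | [::] => fun v => wmon (consw v t')
         | u :: r' => fun v =>
             rec r' (Mul u v) - succ_rev t' (Mul u v :: r')
               + succ_rev t' (v :: u :: r')
         end)^~ v
  end.

Definition succw (s t : W) : freePreAs := succ_rev t (rev s).

Definition bilext (h : W -> W -> freePreAs) (f g : freePreAs) : freePreAs :=
  lext (fun s => lext (h s) g) f.

Definition fstar : freePreAs -> freePreAs -> freePreAs :=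
  bilext (fun s t => wmon (wcat s t)).
Definition fsucc : freePreAs -> freePreAs -> freePreAs := bilext succw.
Definition fprec (f g : freePreAs) : freePreAs := fstar f g - fsucc f g.

Lemma lext_wmon (V : lmodType k) (b : W -> V) w : lext b (wmon w) = b w.
Proof. by rewrite wmonE; exact: lextU. Qed.

Lemma freeE (f : freePreAs) : f = \sum_(w <- msupp f) f@_w *: wmon w.
Proof.
rewrite {1}[f]monalgE; apply: eq_bigr => w _.
by apply/malgP => v; rewrite wmonE mcoeffZ !mcoeffU mulrnAr mulr1.
Qed.

Lemma free_linear_ext (V : lmodType k) (F G : freePreAs -> V) :
  linear F -> linear G -> (forall w, F (wmon w) = G (wmon w)) -> F =1 G.
Proof.
move=> FL GL e f; rewrite [f]freeE !lfun_sum //.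
by apply: eq_bigr => w _; rewrite !lfunZ // e.
Qed.

Lemma bilext_linearl h g : linear (fun f => bilext h f g).
Proof. exact: lext_linear. Qed.

Lemma bilext_linearr h f : linear (bilext h f).
Proof.
move=> a g g'; rewrite /bilext !lextE scaler_sumr -big_split /=.
apply: eq_bigr => s _; rewrite scalerA mulrC -scalerA -scalerDr.
by congr (_ *: _); exact: lext_linear.
Qed.

Lemma bilextU h s t : bilext h (wmon s) (wmon t) = h s t.
Proof. by rewrite /bilext !lext_wmon. Qed.

Lemma lcomp (V1 V2 V3 : lmodType k) (F : V2 -> V3) (G : V1 -> V2) :
  linear F -> linear G -> linear (fun x => F (G x)).
Proof. by move=> FL GL a x y; rewrite GL FL. Qed.

Lemma ladd (V1 V2 : lmodType k) (F G : V1 -> V2) :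
  linear F -> linear G -> linear (fun x => F x + G x).
Proof. by move=> FL GL a x y; rewrite FL GL scalerDr addrACA. Qed.

Lemma lopp (V1 V2 : lmodType k) (F : V1 -> V2) :
  linear F -> linear (fun x => - F x).
Proof. by move=> FL a x y; rewrite FL opprD scalerN. Qed.

Let starl : forall g, linear (fstar^~ g) := bilext_linearl _.
Let starr : forall f, linear (fstar f) := bilext_linearr _.
Let succl : forall g, linear (fsucc^~ g) := bilext_linearl _.
Let succr : forall f, linear (fsucc f) := bilext_linearr _.

Lemma bimul_linear p q : linear (fun f => bimul p f q).
Proof. exact: lext_linear. Qed.

Lemma bimul_wmon p w q : bimul p (wmon w) q = wmon (wcat3 p w q).
Proof. exact: lext_wmon. Qed.

Lemma word_eq (u v : W) : wseq u = wseq v -> u = v.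
Proof. exact: val_inj. Qed.

Lemma fstarA f g h : fstar f (fstar g h) = fstar (fstar f g) h.
Proof.
move: f; apply: free_linear_ext; first exact: starl.
  by apply: (lcomp (F := fstar^~ h)); exact: starl.
move=> s; move: g; apply: free_linear_ext.
- by apply: lcomp; [exact: starr|exact: starl].
- by apply: (lcomp (F := fstar^~ h)); [exact: starl|exact: starr].
move=> t; move: h; apply: free_linear_ext.
- by apply: lcomp; exact: starr.
- exact: starr.
move=> u; rewrite /fstar !bilextU; congr wmon; apply: word_eq.
by rewrite /= !cats0 catA.
Qed.

Lemma succ_rev_cons v t u r :
  succ_rev (v :: t) (u :: r) =
  succ_rev (Mul u v :: t) r - succ_rev t (Mul u v :: r)
    + succ_rev t (v :: u :: r).
Proof. by []. Qed.

Lemma succ_rev0 r : succ_rev [::] r = 0.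
Proof. by []. Qed.

Lemma succ_rev_nil v t : succ_rev (v :: t) [::] = wmon (consw v t).
Proof. by []. Qed.

(* Iterated left action of the reversed sequence [r], [r] possibly empty. *)
Definition act (r : seq U) (f : freePreAs) : freePreAs :=
  lext (fun t : W => succ_rev t r) f.

Lemma act_linear r : linear (act r).
Proof. exact: lext_linear. Qed.
Let actL := act_linear.

Lemma act_comp t r r' : act r (succ_rev t r') = succ_rev t (r' ++ r).
Proof.
elim: t r r' => [|v t IHt] r r'; first by rewrite /= lfun0.
elim: r' v => [|u r' IHr] v.
  by rewrite succ_rev_nil /act lext_wmon.
by rewrite cat_cons !succ_rev_cons lfunD // lfunB // IHr !IHt.
Qed.

Lemma succ_fsucc s g : fsucc (wmon s) g = act (rev s) g.
Proof. by rewrite /fsucc /bilext lext_wmon. Qed.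

Lemma fsuccA f g h : fsucc f (fsucc g h) = fsucc (fstar f g) h.
Proof.
move: f; apply: free_linear_ext; first exact: succl.
  by apply: (lcomp (F := fsucc^~ h)); [exact: succl|exact: starl].
move=> s; move: g; apply: free_linear_ext.
- by apply: lcomp; [exact: succr|exact: succl].
- by apply: (lcomp (F := fsucc^~ h)); [exact: succl|exact: starr].
move=> t; move: h; apply: free_linear_ext.
- by apply: lcomp; exact: succr.
- exact: succr.
move=> u; rewrite /fsucc /fstar !bilextU -/fsucc succ_fsucc /succw act_comp /=.
by rewrite cats0 rev_cat.
Qed.

Definition fold_letter (r : seq U) (v : U) : U := foldl (fun v u => Mul u v) v r.

Lemma succ_rev_letter t v r :
  succ_rev (v :: t) r =
  wmon (consw (fold_letter r v) t) - succ_rev t [:: fold_letter r v]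
    + succ_rev t (v :: r).
Proof.
elim: r v => [|u r IH] v; first by rewrite succ_rev_nil subrK.
by rewrite succ_rev_cons IH /= addrK.
Qed.

Lemma succ_rev_cat (t : W) w v r :
  succ_rev (v :: w ++ t) r =
  (fstar (succ_rev (v :: w) r) (wmon t) - fsucc (succ_rev (v :: w) r) (wmon t))
    + succ_rev t (rev (v :: w) ++ r).
Proof.
pose D f : freePreAs := fstar f (wmon t) - fsucc f (wmon t).
have DL : linear D by apply: ladd; [exact: starl|apply: lopp; exact: succl].
have Dw u p : D (wmon (consw u p)) =
    wmon (consw u (p ++ t)) - succ_rev t (rev (u :: p)).
  rewrite /D.
  rewrite [fstar _ _]bilextU [fsucc _ _]bilextU.
  rewrite (_ : wcat _ _ = consw u (p ++ t)) //.
  by apply: word_eq; rewrite /= cats0.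
rewrite -/(D _); clearbody D; elim: w v r => [|v' w IH] v r.
  rewrite cat0s succ_rev_letter (@succ_rev_letter [::]).
  rewrite !succ_rev0.
  have e (f : freePreAs) : f - 0 + 0 = f by rewrite subr0 addr0.
  by rewrite [X in D X]e Dw cat0s.
rewrite cat_cons succ_rev_letter [in RHS]succ_rev_letter.
rewrite (lfunD DL) (lfunB DL) Dw !IH cat_cons.
rewrite [rev (v :: _)]rev_cons cat_rcons [rev (fold_letter _ _ :: _)]rev_cons -cats1.
have e (a b c d x : freePreAs) :
  a - (b + c) + (d + x) = a - c - b + d + x by rewrite opprD !addrA [_ - b - c]addrAC.
exact: e.
Qed.

Lemma fsuccstarA f g h :
  fsucc f (fstar g h) =
  fstar (fsucc f g) h - fsucc (fsucc f g) h + fsucc f (fsucc g h).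
Proof.
pose R f g h :=
  fstar (fsucc f g) h - fsucc (fsucc f g) h + fsucc f (fsucc g h).
rewrite -/(R f g h); move: f.
apply: (free_linear_ext (F := fun f => fsucc f (fstar g h)) (G := fun f => R f g h)).
- exact: succl.
- apply: ladd; last exact: succl.
  apply: ladd; first by apply: (lcomp (F := fstar^~ h)); [exact: starl|exact: succl].
  by apply: lopp; apply: (lcomp (F := fsucc^~ h)); exact: succl.
move=> s; move: h.
apply: (free_linear_ext (F := fun h => fsucc (wmon s) (fstar g h)) (G := R (wmon s) g)).
- by apply: lcomp; [exact: succr|exact: starr].
- apply: ladd; last by apply: lcomp; exact: succr.
  by apply: ladd; [exact: starr|apply: lopp; exact: succr].
move=> t; move: g.
apply: (free_linear_ext (F := fun g => fsucc (wmon s) (fstar g (wmon t)))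
                        (G := fun g => R (wmon s) g (wmon t))).
- by apply: lcomp; [exact: succr|exact: starl].
- apply: ladd; last by apply: lcomp; [exact: succr|exact: succl].
  apply: ladd.
    by apply: (lcomp (F := fstar^~ (wmon t))); [exact: starl|exact: succr].
  by apply: lopp; apply: (lcomp (F := fsucc^~ (wmon t))); [exact: succl|exact: succr].
rewrite /R {R}.
elim/consw_ind => v w.
have E1 : fsucc (wmon s) (fstar (wmon (consw v w)) (wmon t)) =
    succ_rev (v :: w ++ t) (rev s).
  rewrite (_ : v :: w ++ t = wcat (consw v w) t); last by rewrite /= cats0.
  exact: etrans (congr1 (fsucc (wmon s)) (bilextU _ _ _)) (bilextU _ _ _).
have E2 : fsucc (wmon s) (wmon (consw v w)) = succ_rev (v :: w) (rev s).
  exact: bilextU.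
have E3 : fsucc (wmon s) (fsucc (wmon (consw v w)) (wmon t)) =
    succ_rev t (rev (v :: w) ++ rev s).
  rewrite (_ : rev (v :: w) ++ rev s = rev (wcat s (consw v w))).
    apply: etrans (fsuccA _ _ _) _.
    exact: etrans (congr1 (fsucc^~ (wmon t)) (bilextU _ _ _)) (bilextU _ _ _).
  by rewrite /= cats0 rev_cat.
apply: etrans E1 (etrans (succ_rev_cat t w v (rev s)) (esym _)).
pose D a := fstar a (wmon t) - fsucc a (wmon t).
exact: congr2 (congr1 D E2) E3.
Qed.

Let fprecl : forall h, linear (fprec^~ h).
Proof. by move=> h; apply: ladd; [exact: starl|apply: lopp; exact: succl]. Qed.
Let fprecr : forall h, linear (fprec h).
Proof. by move=> h; apply: ladd; [exact: starr|apply: lopp; exact: succr]. Qed.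

Fact free_psuccA f g h :
  fsucc f (fsucc g h) = fsucc (fsucc f g) h + fsucc (fprec f g) h.
Proof. by rewrite -(lfunD (succl h)) /fprec addrC subrK fsuccA. Qed.

Fact free_psuccprecA f g h : fsucc f (fprec g h) = fprec (fsucc f g) h.
Proof. by rewrite /fprec (lfunB (succr f)) fsuccstarA addrK. Qed.

Fact free_pprecA f g h :
  fprec f (fsucc g h) + fprec f (fprec g h) = fprec (fprec f g) h.
Proof.
rewrite -(lfunD (fprecr f)).
have e0 (a b : freePreAs) : a + (b - a) = b by rewrite addrC subrK.
rewrite [X in fprec f X]e0 /fprec (lfunB (starl h)) (lfunB (succl h)).
rewrite fstarA -fsuccA fsuccstarA.
have e (a b c d : freePreAs) : a - (b - c + d) = a - b - (d - c).
  by rewrite !opprD !opprK !addrA [LHS]addrAC.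
exact: e.
Qed.

HB.instance Definition _ := isPreAs.Build k freePreAs
  succl succr fprecl fprecr free_psuccA free_psuccprecA free_pprecA.

Lemma free_pstarE (f g : freePreAs) : f ⋆ g = fstar f g.
Proof.
have e0 (a b : freePreAs) : a + (b - a) = b by rewrite addrC subrK.
exact: e0.
Qed.

Lemma wmon_star (s t : W) : wmon s ⋆ wmon t = wmon (wcat s t).
Proof. by rewrite free_pstarE [LHS]bilextU. Qed.

Lemma umon_succ (u v : U) : umon u ≻ umon v = umon (Mul u v).
Proof.
rewrite [LHS]bilextU /succw (_ : rev _ = [:: u]) //= -/(letter (Mul u v)).
have e0 (a : freePreAs) : a - 0 + 0 = a by rewrite subr0 addr0.
exact: e0.
Qed.

End FreePreAs.

Section PreAsTheory.
Context (k : fieldType) (A : preAsType k).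
Implicit Types x y z : A.

Lemma psuccD x y z : x ≻ (y + z) = x ≻ y + x ≻ z.
Proof. exact: (lfunD (psucc_linearr x)). Qed.
Lemma psuccDl x y z : (x + y) ≻ z = x ≻ z + y ≻ z.
Proof. exact: (lfunD (psucc_linearl z)). Qed.
Lemma pprecD x y z : x ≺ (y + z) = x ≺ y + x ≺ z.
Proof. exact: (lfunD (pprec_linearr x)). Qed.
Lemma pprecDl x y z : (x + y) ≺ z = x ≺ z + y ≺ z.
Proof. exact: (lfunD (pprec_linearl z)). Qed.

Lemma pstar_linearl y : linear (fun x => x ⋆ y).
Proof. by apply: ladd; [exact: psucc_linearl|exact: pprec_linearl]. Qed.
Lemma pstar_linearr x : linear (pstar x).
Proof. by apply: ladd; [exact: psucc_linearr|exact: pprec_linearr]. Qed.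

Lemma pstar_succ x y z : (x ⋆ y) ≻ z = x ≻ (y ≻ z).
Proof. by rewrite psuccA /pstar psuccDl. Qed.

Lemma pstarA x y z : x ⋆ (y ⋆ z) = (x ⋆ y) ⋆ z.
Proof.
rewrite {1}/pstar [in RHS]/pstar pstar_succ /pstar psuccD pprecDl pprecD.
by rewrite pprecA psuccprecA addrA.
Qed.

Lemma psucc_star x y z :
  x ≻ (y ⋆ z) = (x ≻ y) ⋆ z - (x ≻ y) ≻ z + x ≻ (y ≻ z).
Proof.
by rewrite /pstar psuccD psuccprecA [(x ≻ y) ≻ z + _]addrC addrK addrC.
Qed.

Lemma pprecE x y : x ≺ y = x ⋆ y - x ≻ y.
Proof. by rewrite /pstar addrC addKr. Qed.
End PreAsTheory.

Section Freeness.
Context (k : fieldType) (X : choiceType) (B : preAsType k) (g : X -> B).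

Local Notation U := (naword X).
Local Notation W := (word X).

Fixpoint evU (u : U) : B :=
  match u with Gen x => g x | Mul u v => evU u ≻ evU v end.

Fixpoint evS (s : seq U) : B :=
  match s with
  | [::] => 0
  | u :: s' => if s' is [::] then evU u else evU u ⋆ evS s'
  end.

Lemma evS_cat (s t : seq U) : s != [::] -> t != [::] ->
  evS (s ++ t) = evS s ⋆ evS t.
Proof.
move=> + t0; elim: s => [//|u [|v s] IH] _.
  by case: t t0 {IH}.
by rewrite -[RHS]pstarA -IH.
Qed.

Definition eval_hom (f : freePreAs k X) : B := lext (fun w : W => evS w) f.

Lemma eval_linear : linear eval_hom.
Proof. exact: lext_linear. Qed.
Let evL := eval_linear.

Lemma eval_wmon w : eval_hom (wmon k w) = evS w.
Proof. exact: lext_wmon. Qed.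

Definition evact (r : seq U) (b : B) : B := foldl (fun b u => evU u ≻ b) b r.

Lemma evact_linear r : linear (evact r).
Proof.
elim: r => [|u r IH] a x y //=.
by rewrite -IH; congr (evact r _); exact: psucc_linearr.
Qed.

Lemma evact_rev (s : seq U) b : s != [::] -> evact (rev s) b = evS s ≻ b.
Proof.
elim: s => [//|u [|v s] IH] _ //.
have -> : evact (rev [:: u, v & s]) b = evU u ≻ evact (rev (v :: s)) b.
  by rewrite rev_cons -cats1 /evact foldl_cat.
by rewrite IH // -pstar_succ.
Qed.

Lemma eval_succ_rev t r : eval_hom (succ_rev k t r) = evact r (evS t).
Proof.
elim: t r => [|v t IHt] r.
  by rewrite (lfun0 evL) (lfun0 (evact_linear r)).
elim: r v => [|u r IHr] v; first by rewrite succ_rev_nil eval_wmon.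
rewrite succ_rev_cons (lfunD evL) (lfunB evL) IHr !IHt.
rewrite [evact (Mul _ _ :: _) _]/= [evact (v :: _) _]/= [evact (u :: _) _]/=.
rewrite -(lfunB (evact_linear r)) -(lfunD (evact_linear r)); congr evact.
case: t {IHt IHr} => [|w t] /=; last by rewrite psucc_star.
by rewrite !(lfun0 (psucc_linearr _)) subr0 addr0.
Qed.

Lemma eval_star f h : eval_hom (f ⋆ h) = eval_hom f ⋆ eval_hom h.
Proof.
move: f; apply: (free_linear_ext (F := fun f => eval_hom (f ⋆ h))
                                 (G := fun f => eval_hom f ⋆ eval_hom h)).
- by apply: lcomp => //; exact: pstar_linearl.
- by apply: (lcomp (F := fun x => x ⋆ eval_hom h)) => //; exact: pstar_linearl.
move=> s; move: h; apply: (free_linear_ext (F := fun h => eval_hom (wmon k s ⋆ h))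
                                 (G := fun h => eval_hom (wmon k s) ⋆ eval_hom h)).
- by apply: lcomp => //; exact: pstar_linearr.
- by apply: lcomp => //; exact: pstar_linearr.
move=> t; rewrite wmon_star !eval_wmon /= cats0 evS_cat //; exact: wseq_neq0.
Qed.

Lemma eval_succ f h : eval_hom (f ≻ h) = eval_hom f ≻ eval_hom h.
Proof.
move: f; apply: (free_linear_ext (F := fun f => eval_hom (f ≻ h))
                                 (G := fun f => eval_hom f ≻ eval_hom h)).
- by apply: lcomp => //; exact: psucc_linearl.
- by apply: (lcomp (F := fun x => x ≻ eval_hom h)) => //; exact: psucc_linearl.
move=> s; move: h; apply: (free_linear_ext (F := fun h => eval_hom (wmon k s ≻ h))
                                 (G := fun h => eval_hom (wmon k s) ≻ eval_hom h)).
- by apply: lcomp => //; exact: psucc_linearr.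
- by apply: lcomp => //; exact: psucc_linearr.
move=> t; have -> : wmon k s ≻ wmon k t = succ_rev k t (rev s) by exact: bilextU.
by rewrite eval_succ_rev !eval_wmon evact_rev //; exact: wseq_neq0.
Qed.

Lemma eval_preAs_hom : preAs_hom eval_hom.
Proof.
split; [exact: eval_linear|exact: eval_succ|] => f h.
by rewrite !pprecE (lfunB evL) eval_star eval_succ.
Qed.

Lemma eval_gmon x : eval_hom (gmon k x) = g x.
Proof. exact: eval_wmon. Qed.

Lemma eval_uniq (h : freePreAs k X -> B) :
  preAs_hom h -> (forall x, h (gmon k x) = g x) -> h =1 eval_hom.
Proof.
case=> hL hS hP hg; apply: free_linear_ext => // -[s s0].
rewrite eval_wmon; have hU u : h (umon k u) = evU u.
  elim: u => [x|u IHu v IHv]; first exact: hg.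
  apply: etrans (congr1 h (esym (umon_succ k u v))) _.
  have e := hS (umon k u) (umon k v).
  apply: etrans e _.
  change (h (umon k u) ≻ h (umon k v) = evU u ≻ evU v).
  by move: IHu IHv => -> ->.
case: s s0 => [//|u s] s0; have -> : Word s0 = consw u s by exact: word_eq.
elim: s u {s0} => [|v s IH] u; first exact: hU.
have -> : consw u (v :: s) = wcat (letter u) (consw v s).
  by apply: word_eq; rewrite /= cats0.
have hst x y : h (x ⋆ y) = h x ⋆ h y by rewrite (lfunD hL) hS hP.
apply: etrans (congr1 h (esym (wmon_star k _ _))) _.
have -> : wseq (wcat (letter u) (consw v s)) = [:: u, v & s].
  by rewrite /= cats0.
have e := hst (wmon k (letter u)) (wmon k (consw v s)).
apply: etrans e _.
by move: (hU u) (IH v) => -> ->.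
Qed.
End Freeness.

Theorem freePreAs_is_free (k : fieldType) (X : choiceType) :
  is_free_preAs (@gmon k X).
Proof.
move=> B g; exists (eval_hom g).
  by split; [exact: eval_preAs_hom|move=> x; exact: eval_gmon].
by move=> h; exact: eval_uniq.
Qed.

Section Bimul.
Context (k : fieldType) (X : choiceType).
Implicit Types (f : freePreAs k X) (s t : word X).

Lemma bimulE s f t : bimul s f t = wmon k s ⋆ f ⋆ wmon k t.
Proof.
move: f; apply: free_linear_ext.
- exact: bimul_linear.
- by apply: (lcomp (F := fun f => f ⋆ wmon k t));
    [exact: pstar_linearl|exact: pstar_linearr].
move=> w; rewrite bimul_wmon !wmon_star; congr wmon; apply: word_eq.
by rewrite /= !cats0 catA.
Qed.

Lemma bimul_l s f : bimul s f [::] = wmon k s ⋆ f.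
Proof.
move: f; apply: free_linear_ext.
- exact: bimul_linear.
- exact: pstar_linearr.
by move=> w; rewrite bimul_wmon wmon_star.
Qed.

Lemma bimul_r f t : bimul [::] f t = f ⋆ wmon k t.
Proof.
move: f; apply: free_linear_ext.
- exact: bimul_linear.
- exact: pstar_linearl.
move=> w; rewrite bimul_wmon wmon_star; congr wmon; apply: word_eq.
by rewrite /= cats0.
Qed.

Lemma bimul_nil f : bimul [::] f [::] = f.
Proof.
move: f; apply: free_linear_ext => //; first exact: bimul_linear.
by move=> w; rewrite bimul_wmon; congr wmon; apply: word_eq; rewrite /= cats0.
Qed.
End Bimul.

Fixpoint nalen (X : Type) (u : naword X) : nat :=
  match u with Gen _ => 1%N | Mul u v => (nalen u + nalen v)%N end.

(* Lexicographic comparison of (|u1 u2|, u2, u1): the right factor comes first. *)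
Fixpoint nale (disp : Order.disp_t) (X : orderType disp)
    (u v : naword X) : bool :=
  (nalen u < nalen v)%N ||
  (nalen u == nalen v) &&
    match u, v with
    | Gen x, Gen y => (x <= y)%O
    | Mul u1 u2, Mul v1 v2 => if u2 == v2 then nale u1 v1 else nale u2 v2
    | _, _ => false
    end.

Section GroebnerShirshov.
Context (disp : Order.disp_t) (X : orderType disp).

Local Notation U := (naword X).
Local Notation W := (word X).

Definition ltW (leW : rel W) : rel W := fun u v => (u != v) && leW u v.

Record monomial_order (leW : rel W) : Prop := {
  leW_refl : reflexive leW;
  leW_anti : antisymmetric leW;
  leW_trans : transitive leW;
  leW_total : total leW;
  leW_wf : well_founded (ltW leW);
  leW_catl : forall w u v, leW u v -> leW (wcat w u) (wcat w v);
  leW_catr : forall w u v, leW u v -> leW (wcat u w) (wcat v w);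
  leW_letter : forall u v : U, leW (letter u) (letter v) = nale u v;
  leW_size : forall u v : W,
    (1 < size u)%N -> size v = 1%N -> ltW leW v u
}.

(* One-hole contexts for bracketings (w_1 ... w_k [] w'_1 ... w'_k'). *)
Inductive nactx : Type :=
| Hole
| CMulL of nactx & U
| CMulR of U & nactx.

Fixpoint plug (c : nactx) (u : U) : U :=
  match c with
  | Hole => u
  | CMulL c v => Mul (plug c u) v
  | CMulR v c => Mul v (plug c u)
  end.

Context (k : fieldType).
Local Notation A := (freePreAs k X).

Fixpoint plugp (c : nactx) (f : A) : A :=
  match c with
  | Hole => f
  | CMulL c v => plugp c f ≻ umon k v
  | CMulR v c => umon k v ≻ plugp c f
  end.

Context (leW : rel W).

Definition principal (f : A) (w : W) : Prop :=
  w \in msupp f /\ (forall u, u \in msupp f -> leW u w).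

Definition monicW (f : A) : Prop := exists2 w, principal f w & f@_w = 1.

Context (S : A -> Prop).

Definition S0 (f : A) : Prop :=
  S f /\ (exists2 w, principal f w & size w = 1%N).

Definition S1 (f : A) : Prop := S f /\ ~ S0 f.

Fixpoint S0_iter (n : nat) (f : A) : Prop :=
  match n with
  | 0%N => S0 f
  | n.+1 => exists (g : A) (v : U),
      S0_iter n g /\ (f = umon k v ≻ g \/ f = g ≻ umon k v)
  end.

Definition Shat (f : A) : Prop := (exists n, S0_iter n f) \/ S1 f.

Definition Sreduced (u : W) : Prop :=
  ~ (exists (s : A) (p q : seq U) (w : W),
       [/\ Shat s, principal s w & u = wcat3 p w q]).

Definition trivial_mod (bound : W -> Prop) (h : A) : Prop :=
  exists (n : nat) (a : 'I_n -> k) (p q : 'I_n -> seq U) (s : 'I_n -> A),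
    (forall i, Shat (s i) /\
       (exists2 w, principal (s i) w & bound (wcat3 (p i) w (q i)))) /\
    h = \sum_(i < n) a i *: bimul (p i) (s i) (q i).

Inductive comp_overlap (f g : A) : A -> W -> Prop :=
| Comp1 (wf wg : W) (p q : seq U) :
    principal f wf -> principal g wg -> wf = wcat3 p wg q ->
    comp_overlap f g (f - bimul p g q) wf
| Comp2 (wf wg u w1 w2 : W) :
    principal f wf -> principal g wg -> wf = wcat u w1 -> wg = wcat w2 u ->
    comp_overlap f g (wmon k w2 ⋆ f - g ⋆ wmon k w1) (wcat w2 wf)
| Comp3 (wf : W) (ug : U) (c : nactx) (p q : seq U) :
    principal f wf -> principal g (letter ug) -> c <> Hole ->
    wf = wcat3 p (letter (plug c ug)) q ->
    comp_overlap f g (f - bimul p (plugp c g) q) wf.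

(* When the product is 0 it has no principal word, hence no constructor       *)
(* applies; such a composition is trivial anyway.                             *)
Inductive comp_mult (f : A) : A -> W -> Prop :=
| Comp4 (wf : W) (v : U) (w : W) :
    principal f wf -> (1 < size wf)%N -> principal (f ≻ umon k v) w ->
    comp_mult f (f ≻ umon k v) w
| Comp5 (wf u w : W) :
    principal f wf -> (1 < size wf)%N -> principal (wmon k u ≻ f) w ->
    comp_mult f (wmon k u ≻ f) w.

Definition GSB : Prop :=
  (forall (f g h : A) (w : W), S f -> S g -> comp_overlap f g h w ->
     trivial_mod (fun u => ltW leW u w) h) /\
  (forall (f h : A) (w : W), S f -> comp_mult f h w ->
     trivial_mod (fun u => leW u w) h).

End GroebnerShirshov.

(* Independence is that of the family (b u), so that u |-> b u is injective   *)
(* on P when this holds.                                                      *)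
Definition linear_basis_on (k : fieldType) (K : choiceType) (V : lmodType k)
    (P : K -> Prop) (b : K -> V) : Prop :=
  (forall c : {malg k[K]},
     (forall u, u \in msupp c -> P u) -> lext b c = 0 -> c = 0) /\
  (forall v : V, exists2 c : {malg k[K]},
     (forall u, u \in msupp c -> P u) & v = lext b c).

(* Main.v *)
(** Let J be the span of the w * s * w' with s in Ŝ. The argument has two
    halves.

    If (C4) and (C5) are trivial, then J is the ideal generated by S. For J ≻ u
    with u in U one uses that J ≻ u lies in kU, so that the bound in (C4) forces
    only elements of Ŝ_0 to occur; the axiom
      x ≻ (y * z) = (x ≻ y) * z - (x ≻ y) ≻ z + (x * y) ≻ z
    then extends this to J ≻ A by induction on the length of the right factor,
    and gives A ≻ J ⊆ J by induction on the left factor w of w * s * w'.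

    If (C1)-(C3) are trivial, two elements w * s * w' with the same leading word
    are equal modulo elements of J with smaller leading words. For s in Ŝ_0 this
    is an induction on bracketings, where two disjoint occurrences in a
    bracketing resolve trivially. Cancelling the greatest leading words
    in an element of J therefore ends at its principal word. The remaining
    implications are the division algorithm for the well-order on words. *)

Require Import Defs.
From HB Require Import structures.
From mathcomp Require Import all_boot all_order all_algebra.
From mathcomp Require Import finmap monalg boolp.

Set Implicit Arguments.
Unset Strict Implicit.
Unset Printing Implicit Defensive.

Import Order.TTheory GRing.Theory.
Local Open Scope ring_scope.

(** * Auxiliary identities and factorizations of sequences *)

Lemma subr_sub_sub (V : zmodType) (x y z : V) : x - y = (z - y) - (z - x).
Proof. by rewrite opprB [RHS]addrC addrA subrK. Qed.

(** Levi's lemma for the free monoid, with the shorter prefix on the left. *)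
Lemma cat_eq_prefix (T : eqType) (s1 s2 t1 t2 : seq T) :
  s1 ++ t1 = s2 ++ t2 -> (size s1 <= size s2)%N ->
  exists2 r, s2 = s1 ++ r & t1 = r ++ t2.
Proof.
elim: s1 s2 => [|x s1 IH] [|y s2] //=; first by exists [::].
  by exists (y :: s2).
by case=> <- /IH h /h[r -> ->]; exists r.
Qed.

Lemma scalerBD (R : nzRingType) (V : lmodType R) (a : R) (x y x' y' : V) :
  a *: x + y - (a *: x' + y') = a *: (x - x') + (y - y').
Proof. by rewrite scalerBr addrACA opprD. Qed.

(** * Ideals and the associative product *)

Section IdealClosure.
Context (k : fieldType) (A : preAsType k) (I : A -> Prop) (hI : preAs_ideal I).
Implicit Types x y : A.

Lemma idealD x y : I x -> I y -> I (x + y).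
Proof. by move=> Ix Iy; rewrite -[x]scale1r; exact: (ideal_lin hI). Qed.

Lemma idealZ a x : I x -> I (a *: x).
Proof.
move=> Ix; rewrite -[_ *: _]addr0; apply: (ideal_lin hI) => //.
exact: (ideal0 hI).
Qed.

Lemma idealB x y : I x -> I y -> I (x - y).
Proof. by move=> Ix Iy; apply: idealD => //; rewrite -scaleN1r; exact: idealZ. Qed.

Lemma ideal_starl x y : I y -> I (x ⋆ y).
Proof.
move=> Iy; apply: idealD; first exact: (ideal_succl hI).
exact: (ideal_precl hI).
Qed.

Lemma ideal_starr x y : I x -> I (x ⋆ y).
Proof.
move=> Ix; apply: idealD; first exact: (ideal_succr hI).
exact: (ideal_precr hI).
Qed.
End IdealClosure.

(** * Spans with tagged generators *)

Section TaggedSpan.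
Context (k : fieldType) (K : Type).

(* The tag t of a generator x is meant to be its leading word, so that a bound  *)
(* on leading words in a presentation is a condition B on tags.               *)
Inductive tspan (V : lmodType k) (R : K -> V -> Prop) (B : K -> Prop) :
    V -> Prop :=
| tspan0 : tspan R B 0
| tspan_step a t x y : B t -> R t x -> tspan R B y -> tspan R B (a *: x + y).

Context (V : lmodType k).
Implicit Types (R : K -> V -> Prop) (B : K -> Prop) (x y : V).

Lemma tspanI R B t x : B t -> R t x -> tspan R B x.
Proof.
move=> Bt Rx; rewrite -[x]scale1r -[_ *: _]addr0.
by apply: (tspan_step _ Bt Rx); exact: tspan0.
Qed.

Lemma tspanD R B x y : tspan R B x -> tspan R B y -> tspan R B (x + y).
Proof.
move=> + By; elim=> [|a t z x' Bt Rz _ IH]; first by rewrite add0r.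
by rewrite -addrA; exact: tspan_step Bt Rz IH.
Qed.

Lemma tspanZ R B a x : tspan R B x -> tspan R B (a *: x).
Proof.
elim=> [|b t z x' Bt Rz _ IH]; first by rewrite scaler0; exact: tspan0.
by rewrite scalerDr scalerA; exact: tspan_step Bt Rz IH.
Qed.

Lemma tspanB R B x y : tspan R B x -> tspan R B y -> tspan R B (x - y).
Proof. by move=> Bx By; rewrite -scaleN1r; apply: tspanD => //; exact: tspanZ. Qed.

Lemma tspan_sum R B (I : Type) (r : seq I) (F : I -> V) :
  (forall i, tspan R B (F i)) -> tspan R B (\sum_(i <- r) F i).
Proof.
move=> h; apply: (big_ind (tspan R B)) => //; first exact: tspan0.
by move=> x y; exact: tspanD.
Qed.

Lemma tspan_ex_sum R B x : tspan R B x ->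
  exists n (a : 'I_n -> k) (y : 'I_n -> V),
    (forall i, exists2 t, B t & R t (y i)) /\ x = \sum_(i < n) a i *: y i.
Proof.
elim=> [|a t y z Bt Ry _ [n [b [y' [h ->]]]]].
  by exists 0%N, (fun=> 0), (fun=> 0); rewrite big_ord0; split=> // -[].
pose cons T (z : T) (F : 'I_n -> T) (i : 'I_n.+1) :=
  if unlift ord0 i is Some j then F j else z.
exists n.+1, (cons _ a b), (cons _ y y'); split=> [i|].
  by rewrite /cons; case: (unlift ord0 i) => //; exists t.
rewrite big_ord_recl /cons unlift_none; congr (_ + _).
by apply: eq_bigr => i _; rewrite liftK.
Qed.

(** Generators with tag [t] agree modulo [tspan R B], so their coefficients can be collected on a
    single one. *)
Lemma tspan_top R B t f :
  (forall x y, R t x -> R t y -> tspan R B (x - y)) ->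
  tspan R (fun u => u = t \/ B u) f ->
  tspan R B f \/ exists a x, [/\ a != 0, R t x & tspan R B (f - a *: x)].
Proof.
move=> tB; elim=> [|a u x y tu ux _ IH]; first by left; exact: tspan0.
case: tu ux => [-> tx|Bu ux]; last first.
  case: IH => [IH|[b [z [b0 tz IH]]]]; [left|right]; first exact: tspan_step ux IH.
  by exists b, z; rewrite -addrA; split=> //; exact: tspan_step ux IH.
case: IH => [IH|[b [z [b0 tz IH]]]].
  have [->|a0] := eqVneq a 0; first by left; rewrite scale0r add0r.
  by right; exists a, x; split=> //; rewrite addrC addKr.
have e : a *: x + y - (a + b) *: z = a *: (x - z) + (y - b *: z).
  by rewrite scalerBr scalerDl opprD addrACA.
have h : tspan R B (a *: x + y - (a + b) *: z).
  by rewrite e; apply: tspanD => //; apply: tspanZ; exact: tB.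
(* If the collected coefficient vanishes, nothing with tag [t] is left. *)
have [ab0|ab0] := eqVneq (a + b) 0; last by right; exists (a + b), z.
by left; move: h; rewrite ab0 scale0r subr0.
Qed.

End TaggedSpan.

Section TaggedSpanMap.
Context (k : fieldType) (K : Type) (V : lmodType k).
Implicit Types (R : K -> V -> Prop) (B : K -> Prop) (x : V).

Lemma tspan_map (K' : Type) (V' : lmodType k) R B
    (R' : K' -> V' -> Prop) (B' : K' -> Prop) (F : V -> V') : linear F ->
  (forall t x, B t -> R t x -> tspan R' B' (F x)) ->
  forall x, tspan R B x -> tspan R' B' (F x).
Proof.
move=> FL h x; elim=> [|a t y z Bt Ry _ IH]; first by rewrite lfun0 //; exact: tspan0.
by rewrite FL; apply: tspanD => //; apply: tspanZ; exact: h Bt Ry.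
Qed.

Lemma tspanW R B B' x : (forall t, B t -> B' t) -> tspan R B x -> tspan R B' x.
Proof.
move=> h; apply: (tspan_map (F := id)) => // t z Bt; exact: tspanI (h _ Bt).
Qed.

(** A presentation is finite, so a greatest tag exists unless the presentation is empty, and then
    [x] is zero. *)
Lemma tspan_max (le : rel K) R B x : transitive le -> total le ->
  tspan R B x -> x = 0 \/ exists2 t, B t & tspan R (fun t' => le t' t) x.
Proof.
move=> tr tot; elim=> [|a t y z Bt Ry _ [->|[t' Bt' IH]]]; first by left.
- right; exists t => //; rewrite addr0; apply: tspanZ; apply: tspanI Ry.
  by case/orP: (tot t t).
right; case/orP: (tot t t') => h.
  by exists t' => //; apply: tspan_step Ry IH.
exists t => //; apply: (tspan_step _ _ Ry).
  by case/orP: (tot t t).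
by apply: tspanW IH => t'' /tr; apply.
Qed.

End TaggedSpanMap.

(** * Leading words *)

Section Leading.
Context (disp : Order.disp_t) (X : orderType disp) (k : fieldType).
Context (leW : rel (word X)) (leW_order : monomial_order leW).

Local Notation U := (naword X).
Local Notation W := (word X).
Local Notation A := (freePreAs k X).
Local Notation ltw := (Defs.ltW leW).
Implicit Types (f g : A) (u v w : W) (p q : seq U).

(** * The word order and its compatibility with products *)

Lemma ltww w : ltw w w = false.
Proof. by rewrite /Defs.ltW eqxx. Qed.

Lemma ltw_le u v : ltw u v -> leW u v.
Proof. by case/andP. Qed.

Lemma lew_lt_trans v u w : leW u v -> ltw v w -> ltw u w.
Proof.
move=> uv /andP[vw le]; rewrite /Defs.ltW (leW_trans leW_order uv le) andbT.
apply: contra_neq vw => uw; apply: (leW_anti leW_order).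
by rewrite le -uw.
Qed.

Lemma ltw_le_trans v u w : ltw u v -> leW v w -> ltw u w.
Proof.
move=> /andP[uv le] vw; rewrite /Defs.ltW (leW_trans leW_order le vw) andbT.
apply: contra_neq uv => uw; apply: (leW_anti leW_order).
by rewrite le uw.
Qed.

Lemma lewNlt u v : leW u v -> ~~ ltw v u.
Proof. by move=> uv; apply/negP => /(lew_lt_trans uv); rewrite ltww. Qed.

Lemma lewP u v : leW u v -> u = v \/ ltw u v.
Proof. by move=> uv; case: (eqVneq u v) => [|ne]; [left|right; rewrite /Defs.ltW ne]. Qed.

(** Words of *-length 1 form an initial segment of the order. This turns the bound in (C4) into
    membership in the span of Ŝ_0. *)
Lemma lew_size1 u v : leW u v -> size v = 1%N -> size u = 1%N.
Proof.
move=> uv v1; case: (ltngtP (size u) 1) => // h.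
  by case: u h {uv} => -[].
by have := lewNlt uv; rewrite (leW_size leW_order h v1).
Qed.

Lemma size1_letter w : size w = 1%N -> exists a, w = letter a.
Proof. by case: w => -[|a [|]] //= i _; exists a; exact: word_eq. Qed.

Lemma wcat3_cat p1 p2 w q2 q1 :
  wcat3 p1 (wcat3 p2 w q2) q1 = wcat3 (p1 ++ p2) w (q2 ++ q1).
Proof. by apply: word_eq; rewrite /= !catA. Qed.

Lemma wcat3_le p q u v : leW u v -> leW (wcat3 p u q) (wcat3 p v q).
Proof.
have [ir il] := (leW_catr leW_order, leW_catl leW_order).
move=> uv; have {}uv : leW (wcat3 [::] u q) (wcat3 [::] v q).
  case: q => [|x q]; last first.
    have := ir (consw x q) _ _ uv.
    by congr (leW _ _); apply: word_eq; rewrite /= cats0.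
  by move: uv; congr (leW _ _); apply: word_eq; rewrite /= cats0.
case: p => [//|x p]; have := il (consw x p) _ _ uv.
by congr (leW _ _); apply: word_eq; rewrite /= cats0.
Qed.

Lemma wcat3_inj p q : injective (fun w => wcat3 p w q).
Proof.
move=> u v /(congr1 (@wseq X)) /= e; apply: word_eq.
have : drop (size p) (p ++ u ++ q) = drop (size p) (p ++ v ++ q) by rewrite e.
rewrite !drop_size_cat // => {}e.
have s : size u = size v.
  by move/(congr1 size): e; rewrite !size_cat => /addIn.
by move/eqP: e; rewrite eqseq_cat // => /andP[/eqP].
Qed.

Lemma wcat3_lt p q u v : ltw u v -> ltw (wcat3 p u q) (wcat3 p v q).
Proof.
case/andP => ne le; rewrite /Defs.ltW wcat3_le // andbT.
by apply: contra_neq ne => /wcat3_inj.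
Qed.

Lemma wcat3_size1 p w q : size (wcat3 p w q) = 1%N ->
  [/\ p = [::], q = [::] & size w = 1%N].
Proof.
rewrite /= !size_cat; case: w => -[|x s] //= _.
by case: p => [|y p]; case: q => [|z q];
  rewrite //= ?addn0 ?addnS ?addSn // => -[/eqP]; rewrite ?addn_eq0.
Qed.

Lemma letter_inj : injective (@letter X).
Proof. by move=> u v []. Qed.

Lemma nale_refl (u : U) : nale u u.
Proof. by rewrite -(leW_letter leW_order) (leW_refl leW_order). Qed.

Lemma nale_nalen (u v : U) : nale u v -> (nalen u <= nalen v)%N.
Proof.
(* [nale] begins with the comparison of lengths, so repeating that comparison in front of it changes
   nothing. *)
suff -> : nale u v = (nalen u < nalen v)%N || (nalen u == nalen v) && nale u v.
  by case/orP=> [/ltnW//|/andP[/eqP->]].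
have e (a b c : bool) : a || b && c = a || b && (a || b && c).
  by case: a; case: b; case: c.
by case: u => [x|u1 u2]; case: v => [y|v1 v2]; exact: e.
Qed.

Lemma nale_MulL (u v t : U) : nale u v -> nale (Mul u t) (Mul v t).
Proof.
move=> h; rewrite /= eqxx h andbT orbC -leq_eqVlt leq_add2r.
exact: nale_nalen.
Qed.
Lemma nale_MulR (t u v : U) : nale u v -> nale (Mul t u) (Mul t v).
Proof.
(* The right factors are compared first; only if [u] equals [v] is the common left factor compared
   with itself. *)
move=> h; have e : (if u == v then nale t t else nale u v) = true.
  by rewrite h nale_refl if_same.
by rewrite /= e andbT orbC -leq_eqVlt leq_add2l nale_nalen.
Qed.

(** * Supports and principal words *)

Definition wordmon (w : W) : A -> Prop := fun x => x = wmon k w.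

(** A condition on the support ([below_msupp]), written as a tagged span so that [tspan_map] carries
    it through linear maps. *)
Definition below (B : W -> Prop) : A -> Prop := tspan wordmon B.

(** Monic with principal word [w], by [leadP]; in this form the property passes through linear maps
    that respect the order. *)
Definition lead (f : A) (w : W) : Prop := below (ltw^~ w) (f - wmon k w).

Lemma below_msupp B f : below B f <-> forall w, w \in msupp f -> B w.
Proof.
split=> [|h]; last first.
  rewrite [f]Defs.freeE big_seq; apply: (big_ind (below B)); first exact: tspan0.
    by move=> x y; exact: tspanD.
  by move=> w /h Bw; apply: tspanZ; exact: (tspanI Bw).
elim=> [|a t x y Bt -> _ IH] w; first by rewrite msupp0.
move/(fsubsetP (msuppD_le _ _)); rewrite inE => /orP[|/IH//].
by move/(fsubsetP (msuppZ_le _ _)); rewrite wmonE msuppU oner_eq0 inE => /eqP->.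
Qed.

Lemma below_principal a f w : below (ltw^~ w) (f - a *: wmon k w) ->
  f@_w = a /\ (a != 0 -> principal leW f w).
Proof.
move=> /below_msupp h; have fw : f@_w = a.
  apply/eqP; rewrite -subr_eq0.
  have <- : (a *: wmon k w)@_w = a by rewrite mcoeffZ wmonE mcoeffUU mulr1.
  by rewrite -mcoeffB mcoeff_eq0; apply/negP => /h; rewrite ltww.
split=> // a0; split; first by rewrite -mcoeff_neq0 fw.
move=> u fu; case: (eqVneq u w) => [->|ne]; first exact: leW_refl leW_order _.
apply/ltw_le/h; rewrite -mcoeff_neq0 mcoeffB mcoeffZ wmonE mcoeffU.
by rewrite (eq_sym w) (negPf ne) mulr0 subr0 mcoeff_neq0.
Qed.

Lemma principal_below f w : principal leW f w ->
  below (ltw^~ w) (f - f@_w *: wmon k w).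
Proof.
case=> fw hf; apply/below_msupp => u.
rewrite -mcoeff_neq0 mcoeffB mcoeffZ wmonE mcoeffU /Defs.ltW (eq_sym u).
case: (eqVneq w u) => [<-|ne]; first by rewrite mulr1 subrr eqxx.
by rewrite mulr0 subr0 mcoeff_neq0 => /hf.
Qed.

Lemma leadP f w : lead f w <-> principal leW f w /\ f@_w = 1.
Proof.
split=> [|[[fw hf] f1]].
  rewrite /lead -[wmon k w]scale1r => /below_principal[f1 fw].
  by split=> //; apply: fw; exact: oner_neq0.
by have := principal_below (conj fw hf); rewrite f1 scale1r.
Qed.

Lemma principal_uniq f u v : principal leW f u -> principal leW f v -> u = v.
Proof.
by move=> [fu hu] [fv hv]; apply: (leW_anti leW_order); rewrite hu // hv.
Qed.

Lemma principal_exists B f : below B f -> f <> 0 ->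
  exists2 w, B w & principal leW f w.
Proof.
move=> fB f0; have hB := (below_msupp B f).1 fB.
have : below (fun w => w \in msupp f) f by apply/below_msupp.
case/(tspan_max (leW_trans leW_order) (leW_total leW_order)) => // -[w fw /below_msupp h].
by exists w; [exact: hB|split].
Qed.

Lemma lead_bimul p q f w : lead f w -> lead (bimul p f q) (wcat3 p w q).
Proof.
rewrite /lead -bimul_wmon -(lfunB (bimul_linear p q)).
apply: tspan_map (bimul_linear p q) _ _ => t x tw ->.
by rewrite bimul_wmon; apply: tspanI (erefl _); exact: wcat3_lt.
Qed.

Lemma ltw_MulL (a b c : U) :
  ltw (letter c) (letter a) -> ltw (letter (Mul c b)) (letter (Mul a b)).
Proof.
rewrite /Defs.ltW !(leW_letter leW_order) => /andP[ne /nale_MulL ->].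
by rewrite andbT; apply: contra_neq ne => -[->].
Qed.

Lemma ltw_MulR (a b c : U) :
  ltw (letter c) (letter a) -> ltw (letter (Mul b c)) (letter (Mul b a)).
Proof.
rewrite /Defs.ltW !(leW_letter leW_order) => /andP[ne /nale_MulR ->].
by rewrite andbT; apply: contra_neq ne => -[->].
Qed.

Lemma ltw_letter w (a : U) : ltw w (letter a) -> exists c, w = letter c.
Proof. by move/ltw_le/lew_size1/(_ erefl)/size1_letter. Qed.

(** All words below a letter are letters, and on letters [≻] is the free non-associative product,
    which is monotone for the order. *)
Lemma lead_succl f (a b : U) : lead f (letter a) ->
  lead (umon k b ≻ f) (letter (Mul b a)).
Proof.
rewrite /lead -!/(umon k _) -umon_succ -(lfunB (psucc_linearr _)).
apply: tspan_map (psucc_linearr _) _ _ => t x /[dup] /ltw_letter[c ->] ca ->.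
by rewrite -/(umon k c) umon_succ; apply: tspanI (erefl _); exact: ltw_MulR.
Qed.

Lemma lead_succr f (a b : U) : lead f (letter a) ->
  lead (f ≻ umon k b) (letter (Mul a b)).
Proof.
rewrite /lead -!/(umon k _) -umon_succ -(lfunB (psucc_linearl _)).
apply: tspan_map (psucc_linearl _) _ _ => t x /[dup] /ltw_letter[c ->] ca ->.
by rewrite -/(umon k c) umon_succ; apply: tspanI (erefl _); exact: ltw_MulL.
Qed.

Lemma lead_plugp (c : nactx X) f (a : U) : lead f (letter a) ->
  lead (plugp c f) (letter (plug c a)).
Proof.
by move=> fa; elim: c => [|c IH b|b c IH] //=; [exact: lead_succr|exact: lead_succl].
Qed.

Lemma lead_principal f w : lead f w -> principal leW f w.
Proof. by case/leadP. Qed.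

(** * The set Ŝ *)

Context (S : A -> Prop) (S_monic : forall f, S f -> monicW leW f).

Local Notation S0 := (S0 leW S).
Local Notation Shat := (Shat leW S).

Definition Shat0 (s : A) : Prop := exists n, S0_iter leW S n s.

Lemma S_lead s w : S s -> principal leW s w -> lead s w.
Proof.
move=> /S_monic[w' sw' e] sw; apply/leadP; split=> //.
by rewrite (principal_uniq sw sw').
Qed.

Lemma S0_lead s : S0 s -> exists a, lead s (letter a).
Proof.
case=> Ss [w sw /size1_letter[a e]]; exists a.
by rewrite -e; exact: S_lead.
Qed.

Lemma S0_sub s : S0 s -> S s.
Proof. by case. Qed.

Lemma Shat0_succl s a : Shat0 s -> Shat0 (umon k a ≻ s).
Proof. by case=> n sn; exists n.+1, s, a; split=> //; left. Qed.

Lemma Shat0_succr s a : Shat0 s -> Shat0 (s ≻ umon k a).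
Proof. by case=> n sn; exists n.+1, s, a; split=> //; right. Qed.

(** One-sided products build a bracketing from the inside out, so induction over Ŝ_0 becomes
    induction on one-hole contexts. *)
Lemma Shat0P s : Shat0 s <-> exists2 g, S0 g & exists c, s = plugp c g.
Proof.
split=> [[n]|[g Sg [c ->]]].
  elim: n s => [|n IH] s; first by exists s => //; exists (Hole X).
  case=> g [a [/IH[g' Sg [c ->]] [->|->]]]; exists g' => //.
    by exists (CMulR a c).
  by exists (CMulL c a).
elim: c => [|c IH b|b c IH] /=; first by exists 0%N.
- exact: Shat0_succr.
- exact: Shat0_succl.
Qed.

Lemma Shat0_lead s : Shat0 s -> exists a, lead s (letter a).
Proof.
by case/Shat0P=> g /S0_lead[a ga] [c ->]; exists (plug c a); exact: lead_plugp.
Qed.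

Lemma Shat_lead s w : Shat s -> principal leW s w -> lead s w.
Proof.
case=> [/Shat0_lead[a sa]|[Ss _]]; last exact: S_lead.
by move=> /(principal_uniq (lead_principal sa)) <-.
Qed.

Lemma Shat_size1 s w : Shat s -> principal leW s w -> size w = 1%N -> Shat0 s.
Proof. by case=> // -[Ss nS0] sw w1; case: nS0; split=> //; exists w. Qed.

Lemma S_Shat s : S s -> Shat s.
Proof.
move=> Ss; case: (pselect (S0 s)) => h; last by right.
by left; exists 0%N.
Qed.

(** * Spans of the w * s * w' with bounded leading words *)

Definition Smon (u : W) (x : A) : Prop := exists p s q w,
  [/\ Shat s, principal leW s w, u = wcat3 p w q & x = bimul p s q].

(** Without restriction on the leading words this is J; with one it is triviality modulo [S], by
    [trivial_modE]. *)
Definition Sspan (B : W -> Prop) : A -> Prop := tspan Smon B.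

Lemma Smon_lead u x : Smon u x -> lead x u.
Proof. by case=> p [s [q [w [/Shat_lead h /h sw -> ->]]]]; exact: lead_bimul. Qed.

(** Nothing fits beside [s] in a leading word of *-length 1, and no element of S_1 has such a
    leading word. *)
Lemma Smon_size1 u x : Smon u x -> size u = 1%N -> Shat0 x.
Proof.
case=> p [s [q [w [Ss sw -> ->]]]] /wcat3_size1[-> -> w1].
by rewrite bimul_nil; exact: Shat_size1 Ss sw w1.
Qed.

Lemma Smon_Shat s w : Shat s -> principal leW s w -> Smon w s.
Proof.
move=> Ss sw; exists [::], s, [::], w; split=> //; last by rewrite bimul_nil.
by apply: word_eq; rewrite /= cats0.
Qed.

Lemma bimul_bimul p1 p2 q2 q1 f :
  bimul p1 (bimul p2 f q2) q1 = bimul (p1 ++ p2) f (q2 ++ q1).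
Proof.
move: f; apply: free_linear_ext; last by move=> w; rewrite !bimul_wmon wcat3_cat.
- by apply: (lcomp (bimul_linear _ _)); exact: bimul_linear.
- exact: bimul_linear.
Qed.

Lemma bimulB p q f g : bimul p (f - g) q = bimul p f q - bimul p g q.
Proof. exact: (lfunB (bimul_linear p q)). Qed.

Lemma Smon_bimul p q u x : Smon u x -> Smon (wcat3 p u q) (bimul p x q).
Proof.
case=> p' [s [q' [w [Ss sw -> ->]]]]; exists (p ++ p'), s, (q' ++ q), w.
by rewrite bimul_bimul wcat3_cat.
Qed.

Lemma trivial_modE B h : trivial_mod leW S B h <-> Sspan B h.
Proof.
split=> [[n [a [p [q [s [hs ->]]]]]]|].
  apply: tspan_sum => i; apply: tspanZ; have [Ss [w sw Bw]] := hs i.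
  by apply: (tspanI Bw); exists (p i), (s i), (q i), w.
case/tspan_ex_sum => n [a [y [hy ->]]].
have /choice[c hc] : forall i, exists c : seq U * A * seq U,
    [/\ Shat c.1.2, exists2 w, principal leW c.1.2 w & B (wcat3 c.1.1 w c.2)
      & y i = bimul c.1.1 c.1.2 c.2].
  move=> i; have [t Bt [p [s [q [w [Ss sw et ey]]]]]] := hy i.
  by exists (p, s, q); split=> //=; exists w => //; rewrite -et.
exists n, a, (fun i => (c i).1.1), (fun i => (c i).2), (fun i => (c i).1.2).
split=> [i|]; first by have [] := hc i.
by apply: eq_bigr => i _; have [_ _ ->] := hc i.
Qed.

Lemma Sspan_lt_bimul p q w f : Sspan (ltw^~ w) f ->
  Sspan (ltw^~ (wcat3 p w q)) (bimul p f q).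
Proof.
apply: tspan_map (bimul_linear p q) _ _ => t x tw /(Smon_bimul p q).
by apply: tspanI; exact: wcat3_lt.
Qed.

(** Below a letter only elements of Ŝ_0 occur; multiplication by [b] keeps them in Ŝ_0 and preserves
    the strict order of letters. *)
Lemma Sspan_lt_succl (a b : U) f : Sspan (ltw^~ (letter a)) f ->
  Sspan (ltw^~ (letter (Mul b a))) (umon k b ≻ f).
Proof.
apply: tspan_map (psucc_linearr _) _ _ => t x /[dup] /ltw_letter[c ->] ca tx.
apply: (tspanI (t := letter (Mul b c))); [exact: ltw_MulR|apply: Smon_Shat].
  by left; apply: Shat0_succl; exact: Smon_size1 tx _.
by apply: lead_principal; apply: lead_succl; exact: Smon_lead.
Qed.

Lemma Sspan_lt_succr (a b : U) f : Sspan (ltw^~ (letter a)) f ->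
  Sspan (ltw^~ (letter (Mul a b))) (f ≻ umon k b).
Proof.
apply: tspan_map (psucc_linearl _) _ _ => t x /[dup] /ltw_letter[c ->] ca tx.
apply: (tspanI (t := letter (Mul c b))); [exact: ltw_MulL|apply: Smon_Shat].
  by left; apply: Shat0_succr; exact: Smon_size1 tx _.
by apply: lead_principal; apply: lead_succr; exact: Smon_lead.
Qed.

Lemma Sspan_subC B f g : Sspan B (f - g) -> Sspan B (g - f).
Proof. by move=> h; rewrite -opprB -scaleN1r; exact: tspanZ. Qed.

(** * Disjoint occurrences *)

Definition bimul2 p f r g q : A :=
  bilext (fun u v => wmon k (wcat3 p u (r ++ v ++ q))) f g.

Lemma bimul2_wmonr p f r v q :
  bimul2 p f r (wmon k v) q = bimul p f (r ++ v ++ q).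
Proof.
move: f; apply: free_linear_ext.
- exact: bilext_linearl.
- exact: bimul_linear.
by move=> w; rewrite bimul_wmon; exact: bilextU.
Qed.

Lemma bimul2_wmonl p u r g q :
  bimul2 p (wmon k u) r g q = bimul (p ++ u ++ r) g q.
Proof.
move: g; apply: free_linear_ext.
- exact: bilext_linearr.
- exact: bimul_linear.
move=> w; rewrite bimul_wmon; apply: etrans (bilextU _ _ _) _.
by congr wmon; apply: word_eq; rewrite /= !catA.
Qed.

(** Each of the two terms is p * f * r * g * q with one of [f], [g] replaced by its leading word. *)
Lemma disjoint_confl p f u r g v q :
  Shat f -> Shat g -> principal leW f u -> principal leW g v ->
  Sspan (ltw^~ (wcat3 p u (r ++ v ++ q)))
    (bimul p f (r ++ v ++ q) - bimul (p ++ u ++ r) g q).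
Proof.
move=> Sf Sg fu gv; pose w := wcat3 p u (r ++ v ++ q).
have ew (y : W) : wcat3 p u (r ++ y ++ q) = wcat3 (p ++ u ++ r) y q.
  by apply: word_eq; rewrite /= -!catA.
pose F y := bimul2 p f r y q; pose G x := bimul2 p x r g q.
have FL : linear F by exact: bilext_linearr.
have GL : linear G by exact: bilext_linearl.
(* The product with both [f] and [g] is added and subtracted. Every remaining term has an element of
   Ŝ in one place and a smaller word in the other. *)
have -> : bimul p f (r ++ v ++ q) - bimul (p ++ u ++ r) g q
    = G (f - wmon k u) - F (g - wmon k v).
  rewrite (lfunB FL) (lfunB GL) /F /G bimul2_wmonr bimul2_wmonl.
  exact: subr_sub_sub.
apply: tspanB.
  apply: tspan_map GL _ _ (Shat_lead Sf fu) => x _ xu ->.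
  rewrite /G bimul2_wmonl; apply: (tspanI (t := wcat3 (p ++ x ++ r) v q)).
    have -> : wcat3 (p ++ x ++ r) v q = wcat3 p x (r ++ v ++ q).
      by apply: word_eq; rewrite /= -!catA.
    exact: wcat3_lt.
  by exists (p ++ x ++ r), g, q, v.
apply: tspan_map FL _ _ (Shat_lead Sg gv) => y _ yv ->.
rewrite /F bimul2_wmonr; apply: (tspanI (t := wcat3 p u (r ++ y ++ q))).
  by rewrite !ew; exact: wcat3_lt.
by exists p, f, (r ++ y ++ q), u.
Qed.

(** * Confluence *)

Section Confluence.
Context (gsb : GSB leW S).

Lemma comp_overlap_Sspan f g h w : S f -> S g ->
  comp_overlap leW f g h w -> Sspan (ltw^~ w) h.
Proof.
by move=> Sf Sg fgh; apply/trivial_modE; have [+ _] := gsb; apply; [exact: Sf|exact: Sg|].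
Qed.

Lemma comp_incl f g wf wg p q : S f -> S g -> principal leW f wf ->
  principal leW g wg -> wf = wcat3 p wg q ->
  Sspan (ltw^~ wf) (f - bimul p g q).
Proof.
move=> Sf Sg fw gw e.
by apply: comp_overlap_Sspan Sf Sg _; exact: Comp1 fw gw e.
Qed.

(** The empty context is (C1), a proper one is (C3). *)
Lemma comp_plug f g wf a c p q : S f -> S0 g -> principal leW f wf ->
  principal leW g (letter a) -> wf = wcat3 p (letter (plug c a)) q ->
  Sspan (ltw^~ wf) (f - bimul p (plugp c g) q).
Proof.
move=> Sf /S0_sub Sg fw gw e; case: (pselect (c = Hole X)) => [cH|cN].
  by move: e; rewrite cH; exact: comp_incl.
by apply: comp_overlap_Sspan Sf Sg _; exact: Comp3 fw gw cN e.
Qed.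

(** Induction on the first context. With both holes in the same factor the induction hypothesis
    applies there; in different factors the occurrences are disjoint; if one context is empty, the
    difference is a composition up to sign. *)
Lemma letter_confl c1 c2 g1 g2 a1 a2 : S0 g1 -> S0 g2 ->
  lead g1 (letter a1) -> lead g2 (letter a2) -> plug c1 a1 = plug c2 a2 ->
  Sspan (ltw^~ (letter (plug c1 a1))) (plugp c1 g1 - plugp c2 g2).
Proof.
move=> Sg1 Sg2 ga1 ga2.
have hole g g' a a' c : S0 g -> S0 g' -> lead g (letter a) -> lead g' (letter a') ->
    a = plug c a' -> Sspan (ltw^~ (letter a)) (g - plugp c g').
  move=> /S0_sub Sg Sg' /lead_principal gl /lead_principal gl' e.
  rewrite -[plugp c g']bimul_nil; apply: comp_plug (Sg) (Sg') (gl) (gl') _.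
  by rewrite e; apply: word_eq.
(* Holes in different factors: both terms are compared with [f ≻ f']. *)
have split f f' b b' : Shat0 f -> Shat0 f' -> lead f (letter b) -> lead f' (letter b') ->
    Sspan (ltw^~ (letter (Mul b b'))) (f ≻ umon k b' - umon k b ≻ f').
  move=> Sf Sf' fb fb'.
  have -> : f ≻ umon k b' - umon k b ≻ f' =
      (f - umon k b) ≻ f' - f ≻ (f' - umon k b').
    rewrite (lfunB (psucc_linearl _)) (lfunB (psucc_linearr _)).
    exact: subr_sub_sub.
  apply: tspanB.
    apply: tspan_map (psucc_linearl _) _ _ fb => t x /[dup] /ltw_letter[c ->] cb ->.
    apply: (tspanI (t := letter (Mul c b'))); [exact: ltw_MulL|apply: Smon_Shat].
      by left; exact: Shat0_succl.
    by apply: lead_principal; exact: lead_succl.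
  apply: tspan_map (psucc_linearr _) _ _ fb' => t x /[dup] /ltw_letter[c ->] cb ->.
  apply: (tspanI (t := letter (Mul b c))); [exact: ltw_MulR|apply: Smon_Shat].
    by left; exact: Shat0_succr.
  by apply: lead_principal; exact: lead_succr.
have S0P c g : S0 g -> Shat0 (plugp c g).
  by move=> Sg; apply/Shat0P; exists g => //; exists c.
elim: c1 c2 => [|c1 IH b1|b1 c1 IH] c2.
- exact: hole.
- case: c2 => [|c2 b2|b2 c2] e.
    by rewrite e; apply: Sspan_subC; apply: (hole _ _ a2 a1 (CMulL c1 b1)).
    case: e => e <-; rewrite /= -(lfunB (psucc_linearl _)).
    by apply: Sspan_lt_succr; exact: IH.
  case: e => <- ->.
  by apply: split; [exact: S0P|exact: S0P|exact: lead_plugp|exact: lead_plugp].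
case: c2 => [|c2 b2|b2 c2] e.
  by rewrite e; apply: Sspan_subC; apply: (hole _ _ a2 a1 (CMulR b1 c1)).
  case: e => -> <-; apply: Sspan_subC.
  by apply: split; [exact: S0P|exact: S0P|exact: lead_plugp|exact: lead_plugp].
case: e => <- e; rewrite /= -(lfunB (psucc_linearr _)).
by apply: Sspan_lt_succl; exact: IH.
Qed.

(** For [f] in Ŝ_0 the leading word is a letter, so [p] and [q] are empty and two bracketings are
    compared. For [f] in S_1 the difference is itself a composition (C1) or (C3). *)
Lemma incl_confl f g wf wg p q : Shat f -> Shat g -> principal leW f wf ->
  principal leW g wg -> wf = wcat3 p wg q ->
  Sspan (ltw^~ wf) (f - bimul p g q).
Proof.
move=> [Sf|[Sf _]] Sg fw gw e.
  have [a fa] := Shat0_lead Sf.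
  have ea : wf = letter a := principal_uniq fw (lead_principal fa).
  have [p0 q0 wg1] : [/\ p = [::], q = [::] & size wg = 1%N].
    by apply: wcat3_size1; rewrite -e ea.
  have ew : wf = wg by rewrite e p0 q0; apply: word_eq; rewrite /= cats0.
  rewrite p0 q0 bimul_nil; case/Shat0P: Sf fw => f' Sf' [c1 ->] fw.
  have Sg0 := Shat_size1 Sg gw wg1.
  case/Shat0P: Sg0 gw => g' Sg' [c2 ->] gw.
  have [[b1 fb] [b2 gb]] := (S0_lead Sf', S0_lead Sg').
  have e1 := principal_uniq fw (lead_principal (lead_plugp c1 fb)).
  have e2 := principal_uniq gw (lead_principal (lead_plugp c2 gb)).
  rewrite e1; apply: (letter_confl Sf' Sg' fb gb); apply: letter_inj.
  by rewrite -e1 -e2.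
case: Sg => [/Shat0P[g' Sg' [c eg]]|[Sg _]]; last exact: comp_incl fw gw e.
have [b gb] := S0_lead Sg'; rewrite eg in gw *.
have eb := principal_uniq gw (lead_principal (lead_plugp c gb)).
by apply: (comp_plug Sf Sg' fw (lead_principal gb)); rewrite e eb.
Qed.

(** The two occurrences are disjoint, nested or properly overlapping, which leads to
    [disjoint_confl], [incl_confl] and (C2) respectively. *)
Lemma Shat_confl p1 f u q1 p2 g v q2 : Shat f -> Shat g ->
  principal leW f u -> principal leW g v -> wcat3 p1 u q1 = wcat3 p2 v q2 ->
  Sspan (ltw^~ (wcat3 p1 u q1)) (bimul p1 f q1 - bimul p2 g q2).
Proof.
wlog le : p1 f u q1 p2 g v q2 / (size p1 <= size p2)%N => [hw|].
  case/orP: (leq_total (size p1) (size p2)) => le Sf Sg fu gv e.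
    exact: (hw p1 f u q1 p2 g v q2).
  by rewrite e; apply: Sspan_subC; exact: (hw p2 g v q2 p1 f u q1).
move=> Sf Sg fu gv /(congr1 (@wseq X)) /= e.
(* [d] separates the starting points of the two occurrences. *)
have [d ep {}e] := cat_eq_prefix e le; rewrite {}ep {le}.
case: (leqP (size u) (size d)) => [le|].
  have [r er {}e] := cat_eq_prefix e le; rewrite er e.
  exact: disjoint_confl.
move=> lt; have [u' eu {}e] := cat_eq_prefix (esym e) (ltnW lt).
case: (leqP (size v) (size u')) => [le'|lt'].
  have [t et {}e] := cat_eq_prefix e le'.
  have -> : bimul p1 f q1 - bimul (p1 ++ d) g q2 = bimul p1 (f - bimul d g t) q1.
    by rewrite bimulB bimul_bimul e.
  apply/Sspan_lt_bimul/(incl_confl Sf Sg fu gv).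
  by apply: word_eq; rewrite eu et.
have [v' ev eq1] := cat_eq_prefix (esym e) (ltnW lt').
have -> : bimul p1 f q1 - bimul (p1 ++ d) g q2
    = bimul p1 (bimul [::] f v' - bimul d g [::]) q2.
  by rewrite bimulB !bimul_bimul cats0 eq1.
(* Equal starting points make [u] a prefix of [v]. *)
have [dN|dN] := eqVneq d [::].
  have -> : wcat3 p1 u q1 = wcat3 p1 v q2.
    by apply: word_eq; rewrite /= eq1 eu dN ev cat0s !catA.
  apply/Sspan_lt_bimul/Sspan_subC; rewrite dN bimul_nil.
  by apply: (incl_confl Sg Sf gv fu); apply: word_eq; rewrite /= eu dN ev.
have uN : u' != [::] by apply: contraTneq lt => uN; rewrite eu uN cats0 ltnn.
have vN : v' != [::] by apply: contraTneq lt' => vN; rewrite ev vN cats0 ltnn.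
have size_gt1 (s t : seq U) : s != [::] -> t != [::] -> (1 < size (s ++ t))%N.
  by case: s => // x s; case: t => // y t _ _; rewrite size_cat addSn addnS.
(* Elements of Ŝ_0 have letters as leading words and overlap nothing properly, so both elements lie
   in [S]. *)
have S_of_size h (w : W) : Shat h -> principal leW h w -> (1 < size w)%N -> S h.
  case=> [/Shat0_lead[a ha] hw|[] //].
  by rewrite (principal_uniq hw (lead_principal ha)).
have -> : wcat3 p1 u q1 = wcat3 p1 (wcat (Word dN) v) q2.
  by apply: word_eq; rewrite /= eq1 eu ev cats0 !catA.
apply/Sspan_lt_bimul/Sspan_subC; rewrite (bimul_r _ (Word vN)) (bimul_l (Word dN)).
apply: comp_overlap_Sspan (Comp2 (u := Word uN) gv fu _ _).
- by apply: S_of_size Sg gv _; rewrite ev size_gt1.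
- by apply: S_of_size Sf fu _; rewrite eu size_gt1.
- by apply: word_eq; rewrite /= cats0.
- by apply: word_eq; rewrite /= cats0.
Qed.

(** * The span of the w * s * w' is an ideal *)

Section SpanIsIdeal.

Local Notation J := (Sspan (fun=> True)).
(** This is the span of Ŝ_0, by [Smon_size1] and [Shat0_span0]. *)
Local Notation span0 := (Sspan (fun w => size w = 1%N)).

Lemma span0_Smon u x : size u = 1%N -> Smon u x -> span0 x.
Proof. by move=> u1 ux; exact: tspanI ux. Qed.

Lemma Shat0_span0 s : Shat0 s -> span0 s.
Proof.
move=> Ss; have [a sa] := Shat0_lead Ss.
by apply: (@span0_Smon (letter a)) => //; apply: Smon_Shat; [left|exact: lead_principal].
Qed.

Lemma span0_map (F : A -> A) : linear F ->
  (forall s, Shat0 s -> span0 (F s)) -> forall f, span0 f -> span0 (F f).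
Proof.
by move=> FL h; apply: tspan_map FL _ => t x t1 tx; apply: h; exact: Smon_size1 tx t1.
Qed.

Lemma wmon_ind (P : W -> Prop) : (forall a, P (letter a)) ->
  (forall a w, P w -> P (wcat (letter a) w)) -> forall w, P w.
Proof.
move=> h1 hS; elim/consw_ind => a p; elim: p a => [|b p IH] a; first exact: h1.
have -> : consw a (b :: p) = wcat (letter a) (consw b p).
  by apply: word_eq; rewrite /= cats0.
exact: hS.
Qed.

(** Since (a * w) ≻ f = a ≻ (w ≻ f), a word acts through its letters one by one, and each letter
    preserves Ŝ_0. *)
Lemma span0_succl g f : span0 f -> span0 (g ≻ f).
Proof.
move=> f0; rewrite [g]Defs.freeE (lfun_sum (psucc_linearl _)).
apply: tspan_sum => w; rewrite (lfunZ (psucc_linearl _)); apply: tspanZ.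
elim/wmon_ind: w => [a|a w IH].
  apply: span0_map (psucc_linearr _) _ _ f0 => s Ss.
  by apply: Shat0_span0; exact: Shat0_succl.
rewrite -wmon_star pstar_succ.
apply: span0_map (psucc_linearr _) _ _ IH => s Ss.
by apply: Shat0_span0; exact: Shat0_succl.
Qed.

Lemma wmon_succ_umon w (a : U) : exists b, wmon k w ≻ umon k a = umon k b.
Proof.
elim/wmon_ind: w => [b|b w [c e]]; first by exists (Mul b a); rewrite umon_succ.
by exists (Mul b c); rewrite -wmon_star pstar_succ e umon_succ.
Qed.

(** By the same identity any word acting on a letter gives a letter; hence the principal word in
    (C4) is a letter. *)
Lemma below1_succr f (a : U) : below (fun w => size w = 1%N) (f ≻ umon k a).
Proof.
rewrite [f]Defs.freeE (lfun_sum (psucc_linearl _)).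
apply: tspan_sum => w; rewrite (lfunZ (psucc_linearl _)); apply: tspanZ.
by have [b ->] := wmon_succ_umon w a; apply: (tspanI (t := letter b)).
Qed.

Lemma Sspan_bimul p q f : J f -> J (bimul p f q).
Proof.
by apply: tspan_map (bimul_linear p q) _ _ => t x _ /(Smon_bimul p q); exact: tspanI.
Qed.

Lemma comp_mult_Sspan f h w : S f -> comp_mult leW f h w -> Sspan (leW^~ w) h.
Proof. by move=> Sf fh; apply/trivial_modE; have [_] := gsb; apply; [exact: Sf|]. Qed.

Lemma S1_size f w : S1 leW S f -> principal leW f w -> (1 < size w)%N.
Proof.
case=> Sf nS0 fw; rewrite ltn_neqAle; apply/andP; split; last by case: w {fw} => -[].
by apply/eqP => w1; apply: nS0; split=> //; exists w.
Qed.

Lemma Shat_succr_umon s (a : U) : Shat s -> span0 (s ≻ umon k a).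
Proof.
case=> [Ss|Ss]; first by apply: Shat0_span0; exact: Shat0_succr.
(* A zero product has no principal word and gives no composition (C4). *)
case: (pselect (s ≻ umon k a = 0)) => [->|n0]; first exact: tspan0.
have [w w1 hw] := principal_exists (below1_succr s a) n0.
have [sw sP _] := S_monic Ss.1.
have := comp_mult_Sspan Ss.1 (Comp4 sP (S1_size Ss sP) hw).
by apply: tspanW => t /lew_size1; apply.
Qed.

Lemma Shat_succl g s : Shat s -> J (g ≻ s).
Proof.
case=> Ss.
  apply: (tspanW (B := fun w => size w = 1%N)) => //.
  by apply: span0_succl; exact: Shat0_span0.
rewrite [g]Defs.freeE (lfun_sum (psucc_linearl _)).
apply: tspan_sum => w; rewrite (lfunZ (psucc_linearl _)); apply: tspanZ.
case: (pselect (wmon k w ≻ s = 0)) => [->|n0]; first exact: tspan0.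
have b0 : below (fun=> True) (wmon k w ≻ s) by apply/below_msupp.
have [u _ hu] := principal_exists b0 n0.
have [sw sP _] := S_monic Ss.1.
have := comp_mult_Sspan Ss.1 (Comp5 sP (S1_size Ss sP) hu).
exact: tspanW.
Qed.

(* The span of Ŝ_0 suffices: s ≻ u with s in S_1 lies in kU, and by (C4) its    *)
(* presentation only involves words of *-length 1.                            *)
Lemma Sspan_succr_umon f (a : U) : J f -> span0 (f ≻ umon k a).
Proof.
apply: tspan_map (psucc_linearl _) _ _ => t x _ [p [s [q [w [Ss sw _ ->]]]]].
have hr b : span0 (bimul p s [::] ≻ umon k b).
  case: p => [|c p]; first by rewrite bimul_nil; exact: Shat_succr_umon.
  rewrite (bimul_l (consw c p)) pstar_succ; apply: span0_succl.
  exact: Shat_succr_umon.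
case: q => [|c q]; first exact: hr.
have -> : bimul p s (c :: q) = bimul p s [::] ⋆ wmon k (consw c q).
  by rewrite -bimul_r bimul_bimul.
by rewrite pstar_succ; have [b ->] := wmon_succ_umon (consw c q) a; exact: hr.
Qed.

Lemma Sspan_starr f g : J f -> J (f ⋆ g).
Proof.
move=> fJ; rewrite [g]Defs.freeE (lfun_sum (pstar_linearr _)).
apply: tspan_sum => w; rewrite (lfunZ (pstar_linearr _)); apply: tspanZ.
by rewrite -bimul_r; exact: Sspan_bimul.
Qed.

Lemma Sspan_starl f g : J f -> J (g ⋆ f).
Proof.
move=> fJ; rewrite [g]Defs.freeE (lfun_sum (pstar_linearl _)).
apply: tspan_sum => w; rewrite (lfunZ (pstar_linearl _)); apply: tspanZ.
by rewrite -bimul_l; exact: Sspan_bimul.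
Qed.

Lemma Sspan_succr f g : J f -> J (f ≻ g).
Proof.
move=> fJ; rewrite [g]Defs.freeE (lfun_sum (psucc_linearr _)).
apply: tspan_sum => w; rewrite (lfunZ (psucc_linearr _)); apply: tspanZ.
have span0J h : span0 h -> J h by exact: tspanW.
(* [f] stays general, because the hypothesis is used for [f ≻ a] and [f ⋆ a]. *)
elim/wmon_ind: w f fJ => [a|a w IH] f fJ; first exact/span0J/Sspan_succr_umon.
have faJ : J (f ≻ umon k a) by exact/span0J/Sspan_succr_umon.
rewrite -wmon_star psucc_star -pstar_succ; apply: tspanD.
  by apply: tspanB; [exact: Sspan_starr|exact: IH].
by apply: IH; exact: Sspan_starr.
Qed.

Lemma Sspan_succl f g : J f -> J (g ≻ f).
Proof.
apply: tspan_map (psucc_linearr _) _ _ => t x _ [p [s [q [w [Ss sw _ ->]]]]].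
have sJ : J s by apply: tspanI (Smon_Shat Ss sw).
(* [g] stays general: removing the letter [a] from the left factor replaces it by [g ≻ a] and
   [g ⋆ a]. *)
elim: p g => [|a p IH] g.
  case: q => [|b q]; first by rewrite bimul_nil; exact: Shat_succl.
  (* With nothing on the left, all three terms are right multiples of elements of J. *)
  rewrite (bimul_r _ (consw b q)) psucc_star -pstar_succ.
  have gJ : J (g ≻ s) by exact: Shat_succl.
  apply: tspanD; first by apply: tspanB; [exact: Sspan_starr|exact: Sspan_succr].
  by apply: Sspan_succr; exact: Sspan_starl.
have -> : bimul (a :: p) s q = umon k a ⋆ bimul p s q.
  by rewrite /umon -bimul_l bimul_bimul cats0.
rewrite psucc_star -pstar_succ; apply: tspanD; last exact: IH.
apply: tspanB; last exact: IH.
by apply: Sspan_starl; apply: Sspan_bimul.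
Qed.

Lemma Sspan_ideal : preAs_ideal J.
Proof.
split.
- exact: tspan0.
- by move=> a x y xJ yJ; apply: tspanD => //; exact: tspanZ.
- by move=> x y; exact: Sspan_succl.
- by move=> x y; exact: Sspan_succr.
- by move=> x y yJ; rewrite pprecE; apply: tspanB; [exact: Sspan_starl|exact: Sspan_succl].
- by move=> x y xJ; rewrite pprecE; apply: tspanB; [exact: Sspan_starr|exact: Sspan_succr].
Qed.

Lemma ideal_gen_Sspan f : ideal_gen S f -> J f.
Proof.
apply; first exact: Sspan_ideal.
move=> s /[dup] /S_monic[w sw _] /S_Shat Ss; exact: tspanI (Smon_Shat Ss sw).
Qed.

End SpanIsIdeal.

(** Well-founded induction on a bound [w] for the leading words in a presentation of [f]. *)
Lemma gsb_principal f : ideal_gen S f -> f <> 0 ->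
  exists s p q w, [/\ Shat s, principal leW s w & principal leW f (wcat3 p w q)].
Proof.
move/ideal_gen_Sspan => fJ f0.
case: (tspan_max (leW_trans leW_order) (leW_total leW_order) fJ) => // -[w _].
elim/(well_founded_ind (leW_wf leW_order)): w f f0 {fJ} => w IH f f0 fw.
have tB x y : Smon w x -> Smon w y -> Sspan (ltw^~ w) (x - y).
  move=> [p [s [q [u [Ss su eu ->]]]]] [p' [s' [q' [u' [Ss' su' eu' ->]]]]].
  by rewrite eu; apply: (Shat_confl Ss Ss' su su'); rewrite -eu.
have /(tspan_top tB) : Sspan (fun u => u = w \/ ltw u w) f.
  by apply: tspanW fw => u; exact: lewP.
(* Either the top terms cancel and a smaller bound holds, or one survives and makes [w]
   principal. *)
case=> [|[a [x [a0 wx fx]]]].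
  move/(tspan_max (leW_trans leW_order) (leW_total leW_order)) => [//|[u uw fu]].
  exact: IH fu.
case: (wx) => p [s [q [u [Ss su eu _]]]]; exists s, p, q, u; split=> //; rewrite -eu.
have fa : below (ltw^~ w) (f - a *: wmon k w).
  have -> : f - a *: wmon k w = (f - a *: x) + a *: (x - wmon k w).
    by rewrite scalerBr addrA subrK.
  apply: tspanD; last by apply: tspanZ; exact: Smon_lead wx.
  apply: (tspan_map (F := id) _ _ fx) => // t y tw /Smon_lead ty.
  have -> : y = (y - wmon k t) + wmon k t by rewrite subrK.
  apply: tspanD; last exact: (tspanI (t := t)).
  by apply: tspanW ty => v vt; exact: ltw_le_trans vt (ltw_le tw).
by have [_] := below_principal fa; apply.
Qed.

End Confluence.

(** * Division *)

Local Notation I := (ideal_gen S).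
Local Notation reduced := (Sreduced leW S).

Let I_ideal : preAs_ideal I := ideal_gen_ideal S.

Lemma ideal_plugp c f : I f -> I (plugp c f).
Proof.
move=> If; elim: c => [|c IH a|a c IH] //=.
  exact: (ideal_succr I_ideal).
exact: (ideal_succl I_ideal).
Qed.

(** The empty word is not an element of the algebra, so an empty side is treated separately. *)
Lemma ideal_bimul p f q : I f -> I (bimul p f q).
Proof.
move=> If; have -> : bimul p f q = bimul p (bimul [::] f q) [::].
  by rewrite bimul_bimul !cats0.
have {If} : I (bimul [::] f q).
  case: q => [|a q]; first by rewrite bimul_nil.
  by rewrite (bimul_r _ (consw a q)); exact: (ideal_starr I_ideal).
case: p => [|a p] h; first by rewrite bimul_nil.
by rewrite (bimul_l (consw a p)); exact: (ideal_starl I_ideal).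
Qed.

Lemma ideal_Shat s : Shat s -> I s.
Proof.
case=> [/Shat0P[g [Sg _] [c ->]]|[Ss _]]; last by move=> J _; apply.
by apply: ideal_plugp => J _; apply.
Qed.

Lemma ideal_Smon u x : Smon u x -> I x.
Proof. by case=> p [s [q [w [/ideal_Shat Is _ _ ->]]]]; exact: ideal_bimul. Qed.

Lemma lead_sub f g w : lead f w -> lead g w -> below (ltw^~ w) (f - g).
Proof.
move=> fw gw; have -> : f - g = (f - wmon k w) - (g - wmon k w).
  by rewrite opprB addrA subrK.
exact: tspanB.
Qed.

Lemma lead_reduce f x w : principal leW f w -> lead x w ->
  below (ltw^~ w) (f - f@_w *: x).
Proof.
move=> /principal_below fw xw.
have -> : f - f@_w *: x = (f - f@_w *: wmon k w) - f@_w *: (x - wmon k w).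
  by rewrite scalerBr opprB addrA subrK.
by apply: tspanB => //; exact: tspanZ.
Qed.

(** Compositions (C1)-(C3) are differences of two elements of the ideal that are monic with the same
    principal word [w]. *)
Lemma comp_overlap_below f g h w : S f -> S g -> comp_overlap leW f g h w ->
  I h /\ below (ltw^~ w) h.
Proof.
move=> Sf Sg; have SI s : S s -> I s by move=> Ss; apply: ideal_Shat; exact: S_Shat.
have [If Ig] := (SI f Sf, SI g Sg).
case=> [wf wg p q fw gw e|wf wg u w1 w2 fw gw ef eg|wf a c p q fw gw _ e].
- split; first by apply: (idealB I_ideal) => //; exact: ideal_bimul.
  apply: lead_sub; first exact: S_lead.
  by rewrite e; apply: lead_bimul; exact: S_lead.
- split.
    apply: (idealB I_ideal); first exact: (ideal_starl I_ideal).
    exact: (ideal_starr I_ideal).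
  rewrite -bimul_l -bimul_r; apply: lead_sub.
    by apply: lead_bimul; exact: S_lead.
  have -> : wcat w2 wf = wcat3 [::] wg w1.
    by apply: word_eq; rewrite ef eg /= !cats0 catA.
  by apply: lead_bimul; exact: S_lead.
split; first by apply: (idealB I_ideal) => //; apply: ideal_bimul; exact: ideal_plugp.
apply: lead_sub; first exact: S_lead.
by rewrite e; apply: lead_bimul; apply: lead_plugp; exact: S_lead.
Qed.

Lemma comp_mult_below f h w : S f -> comp_mult leW f h w ->
  I h /\ below (leW^~ w) h.
Proof.
move=> Sf; have If : I f by apply: ideal_Shat; exact: S_Shat.
case=> [wf a u _ _ [_ hu]|wf u v _ _ [_ hu]]; split; try exact/below_msupp.
  exact: (ideal_succr I_ideal).
exact: (ideal_succl I_ideal).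
Qed.

(** * Condition (ii) and the triviality of compositions *)

Definition principal_in_Shat : Prop := forall f, I f -> f <> 0 ->
  exists s p q w, [/\ Shat s, principal leW s w & principal leW f (wcat3 p w q)].

(** Division: a multiple of some w * s * w' removes the principal term, and the remainder stays in
    the ideal with smaller words. *)
Lemma ideal_Sspan (hS : principal_in_Shat) w f :
  I f -> below (leW^~ w) f -> Sspan (leW^~ w) f.
Proof.
elim/(well_founded_ind (leW_wf leW_order)): w f => w IH f If fw.
case: (pselect (f = 0)) => [->|f0]; first exact: tspan0.
have [s [p [q [u [Ss su fu]]]]] := hS f If f0.
have vw : leW (wcat3 p u q) w by apply: (below_msupp _ _).1 fw _ _; case: fu.
have xv : Smon (wcat3 p u q) (bimul p s q) by exists p, s, q, u.
have gv := lead_reduce fu (Smon_lead xv).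
move: (wcat3 p u q) (bimul p s q) vw xv gv fu => v x vw xv gv fv.
rewrite -[f](subrK (f@_v *: x)); apply: tspanD; last first.
  by apply: tspanZ; exact: (tspanI _ xv).
have Ig : I (f - f@_v *: x).
  apply: (idealB I_ideal) => //; apply: (idealZ I_ideal).
  exact: ideal_Smon xv.
case: (tspan_max (leW_trans leW_order) (leW_total leW_order) gv) => [->|[t tv gt]].
  exact: tspan0.
have tw := ltw_le_trans tv vw.
by apply: tspanW (IH t tw _ Ig gt) => r rt; exact: (leW_trans leW_order rt (ltw_le tw)).
Qed.

Lemma principal_in_Shat_gsb : principal_in_Shat -> GSB leW S.
Proof.
move=> hS; split=> [f g h w Sf Sg /(comp_overlap_below Sf Sg)[Ih hw]|f h w Sf].
  apply/trivial_modE.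
  (* The strict bound comes from dividing with the greatest word [t] in a presentation of [h], which
     is itself below [w]. *)
  case: (tspan_max (leW_trans leW_order) (leW_total leW_order) hw) => [->|[t tw ht]].
    exact: tspan0.
  by apply: tspanW (ideal_Sspan hS Ih ht) => u ut; exact: lew_lt_trans ut tw.
by case/(comp_mult_below Sf) => Ih hw; apply/trivial_modE; exact: ideal_Sspan.
Qed.

(** * Normal forms modulo the ideal *)

Definition reducible_to (B : W -> Prop) (f : A) : Prop :=
  exists2 c, below (fun u => B u /\ reduced u) c & I (f - c).

Lemma reducible_below B f :
  (forall w, B w -> reducible_to B (wmon k w)) -> below B f -> reducible_to B f.
Proof.
move=> h; elim=> [|a t x y Bt -> _ [c cB Ic]].
  by exists 0; [exact: tspan0|rewrite subr0; exact: (ideal0 I_ideal)].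
have [d dB Id] := h t Bt; exists (a *: d + c).
  by apply: tspanD => //; exact: tspanZ.
by rewrite scalerBD; exact: (ideal_lin I_ideal).
Qed.

(** A word that is not reduced is the leading word of some w * s * w' in the ideal, hence congruent
    to minus the remaining smaller words. *)
Lemma reducible_wmon w : reducible_to (leW^~ w) (wmon k w).
Proof.
elim/(well_founded_ind (leW_wf leW_order)): w => w IH.
case: (pselect (reduced w)) => [wr|/contrapT[s [p [q [u [Ss su ew]]]]]].
  exists (wmon k w); last by rewrite subrr; exact: (ideal0 I_ideal).
  by apply: (tspanI (t := w)) => //; split=> //; exact: leW_refl leW_order _.
have xw : Smon w (bimul p s q) by exists p, s, q, u.
move: (bimul p s q) xw => x xw.
have [c cw Ic] : reducible_to (ltw^~ w) (x - wmon k w).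
  apply: reducible_below (Smon_lead xw) => v vw; have [c cv Ic] := IH v vw.
  by exists c => //; apply: tspanW cv => t [tv tr]; split=> //; exact: lew_lt_trans tv vw.
(* [c] is a normal form of [x - wmon k w], and [x] lies in the ideal. *)
exists (- c).
  rewrite -scaleN1r; apply: tspanZ; apply: tspanW cw => t [tw tr].
  by split=> //; exact: ltw_le.
have -> : wmon k w - - c = x - (x - wmon k w - c).
  by rewrite opprK !opprB [RHS]addrC -addrA subrK addrC.
by apply: (idealB I_ideal) => //; exact: ideal_Smon xw.
Qed.

Lemma reducible_all (B : W -> Prop) f : (forall u v, leW u v -> B v -> B u) ->
  below B f -> reducible_to B f.
Proof.
move=> hB; apply: reducible_below => w Bw; have [c cw Ic] := reducible_wmon w.
by exists c => //; apply: tspanW cw => t [tw tr]; split=> //; exact: hB tw Bw.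
Qed.

(** * Reduced words in the quotient *)

Lemma lext_quot_pi (f : A) : lext (fun u => quot_pi S (wmon k u)) f = quot_pi S f.
Proof.
move: f; apply: free_linear_ext; [exact: lext_linear|exact: quot_pi_linear|].
by move=> w; rewrite lext_wmon.
Qed.

Lemma quot_pi_eq0 f : quot_pi S f = 0 <-> I f.
Proof.
rewrite -(lfun0 (quot_pi_linear S)); split=> [/quot_piP|h].
  by rewrite subr0.
by apply/quot_piP; rewrite subr0.
Qed.

(** A nontrivial relation among reduced words is an element of the ideal with reduced principal
    word, which (ii) excludes; spanning is division. Conversely, an element of the ideal with
    reduced principal word would give a nontrivial relation. *)
Lemma principal_in_Shat_basis : principal_in_Shat <->
  linear_basis_on reduced (fun u => quot_pi S (wmon k u)).
Proof.
split=> [hS|[indep _] f If f0].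
  split=> [c cr|v].
    rewrite lext_quot_pi => /quot_pi_eq0 Ic; apply: contrapT => c0.
    have [s [p [q [w [Ss sw [cw _]]]]]] := hS c Ic c0.
    by apply: (cr _ cw); exists s, p, q, w.
  have [f ->] := quot_pi_surj v.
  have [c cr Ic] : reducible_to (fun=> True) f.
    by apply: reducible_all => //; apply/below_msupp.
  exists c; first by move=> u /((below_msupp _ _).1 cr)[].
  by rewrite lext_quot_pi; apply/quot_piP.
have [w _ fw] : exists2 w, True & principal leW f w.
  by apply: principal_exists f0; exact/below_msupp.
apply: contrapT => nw; have wr : reduced w.
  by case=> s [p [q [u [Ss su ew]]]]; apply: nw; exists s, p, q, u; rewrite -ew.
have [c cr Ic] : reducible_to (ltw^~ w) (f - f@_w *: wmon k w).
  apply: reducible_all (principal_below fw) => u v; exact: lew_lt_trans.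
(* [d] is congruent to [f], uses reduced words only, and keeps the coefficient of [f] at [w],
   because [c] lies strictly below [w]. *)
pose d := f@_w *: wmon k w + c.
have d0 : d = 0.
  apply: indep.
    apply/below_msupp; apply: tspanD; last by apply: tspanW cr => u [].
    by apply: tspanZ; apply: (tspanI (t := w)).
  rewrite lext_quot_pi; apply/quot_pi_eq0.
  have -> : d = f - (f - f@_w *: wmon k w - c) by rewrite /d -addrA -opprD subKr.
  exact: (idealB I_ideal).
have /below_principal[e _] : below (ltw^~ w) (d - f@_w *: wmon k w).
  by rewrite /d addrC addKr; apply: tspanW cr => u [].
by case: fw => + _; rewrite -mcoeff_neq0 -e d0 mcoeff0 eqxx.
Qed.

End Leading.

Theorem theorem4 (k : fieldType) (disp : Order.disp_t) (X : orderType disp)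
    (X_nonempty : inhabited X)
    (X_wf : well_founded (fun x y : X => (x < y)%O))
    (leW : rel (word X)) (leW_order : monomial_order leW)
    (S : freePreAs k X -> Prop) (S_monic : forall f, S f -> monicW leW f) :
  let i := GSB leW S in
  let ii := forall f : freePreAs k X, ideal_gen S f -> f <> 0 ->
    exists (s : freePreAs k X) (p q : seq (naword X)) (w : word X),
      [/\ Shat leW S s, principal leW s w & principal leW f (wcat3 p w q)] in
  let iii := linear_basis_on (Sreduced leW S)
    (fun u : word X => quot_pi S (wmon k u)) in
  (i <-> ii) /\ (ii <-> iii).
Proof.
split; last exact: principal_in_Shat_basis.
split; last exact: principal_in_Shat_gsb.
by move=> gsb f; exact: gsb_principal.
Qed.
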